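(* Let $r \ge 2$ be a fixed integer. For any real number $\epsilon > 0$, \[\limsup_{k \to \infty} \frac{\chi_i\big(K(2k+r,k)\big)}{k^r} \leq 2^r + \epsilon.\]
   Context: The Kneser graph $K(n,k)$ has as vertices the $k$-element subsets of an $n$-element set, adjacent iff disjoint. The injective chromatic number $\chi_i(G)$ of a graph $G$ is the least number of colors in a vertex coloring in which any two distinct vertices with a common neighbor receive different colors. *)

(* Defs.v *)
From mathcomp Require Import all_boot.

Set Implicit Arguments.
Unset Strict Implicit.
Unset Printing Implicit Defensive.

(* Graphs are adjacency relations on a finite vertex type. *)

Section InjectiveColoring.
Variables (V : finType) (adj : rel V).

Definition common_neighbor (x y : V) : bool :=
  [exists z, adj x z && adj y z].

Definition injective_coloring (m : nat) (c : {ffun V -> 'I_m}) : bool :=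
  [forall x, forall y, (x != y) && common_neighbor x y ==> (c x != c y)].

Definition injective_colorable (m : nat) : bool :=
  [exists c : {ffun V -> 'I_m}, injective_coloring c].

Lemma injective_colorable_card : injective_colorable #|V|.
Proof.
apply/existsP; exists [ffun x => enum_rank x].
apply/forallP => x; apply/forallP => y; apply/implyP => /andP[xy _].
by rewrite !ffunE (inj_eq enum_rank_inj).
Qed.

Lemma ex_injective_colorable : exists m, injective_colorable m.
Proof. by exists #|V|; exact: injective_colorable_card. Qed.

Definition injective_chromatic_number : nat := ex_minn ex_injective_colorable.

End InjectiveColoring.

Definition kneser_vertex (n k : nat) : finType :=
  {A : {set 'I_n} | #|A| == k}.

(* For k = 0 the only vertex, the empty set, is disjoint from itself; this loop
   does not affect injective colorings, which constrain distinct vertices. *)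
Definition kneser_adj (n k : nat) : rel (kneser_vertex n k) :=
  fun A B => [disjoint val A & val B].

Lemma kneser_adj_sym (n k : nat) : symmetric (@kneser_adj n k).
Proof. by move=> A B; rewrite /kneser_adj disjoint_sym. Qed.

Lemma kneser_adj_irrefl (n k : nat) : 0 < k -> irreflexive (@kneser_adj n k).
Proof.
move=> k0 A; rewrite /kneser_adj -setI_eq0 setIid -cards_eq0 (eqP (valP A)).
by case: k k0 A.
Qed.

(* Main.v *)
Require Import Defs.
From mathcomp Require Import all_boot all_order all_algebra all_field.
From mathcomp Require Import boolp classical_sets reals ereal topology normedtype sequences exp.
From mathcomp Require Import ring lra zify.
(** For a finite field with at least n = 2k + r elements, embed the ground set into the
field and colour a k-set by the top r coefficients after the leading one of the monic
polynomial vanishing on it. Two k-sets with a common neighbour share all but at most r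
elements, so the difference of their polynomials is divisible by a polynomial of degree
at least k - r, and equal colours force equality. Hence chi_i <= q^r for every prime
power q >= n.

It remains to find a prime power in (N, (1 + delta) N] for N large. Suppose there is
none, with M ~ (1 + delta) N, and let a(n) be the normalized number of prime powers
(weighted by vonMangoldt) in (N/n, M/n]. Selberg's formula at M/n and N/n gives
  a(n) ln (N/n) + sum_m Lambda(m)/m a(nm) = 2 ln (N/n) + O(1),
and a(1) = 0. With Mertens' theorem, a is 2 on average over prime powers, hence 0 on
average over products of two of them. But a has average 1 on every window (V, BV] with B
large and is nearly Lipschitz (both by Selberg's formula), so in every window it stays
between 1/4 and 7/4 on some interval (v, (1 + 1/q) v], where Selberg's formula provides
many primes and products of two primes. Summing over the windows gives a contradiction
of order (ln N)^2. *)

Set Implicit Arguments.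
Unset Strict Implicit.
Unset Printing Implicit Defensive.
Import Order.TTheory GRing.Theory Num.Theory.
Local Open Scope ring_scope.

(** * Divisor sums and sums over pairs with bounded product *)

Section FloorSums.
Variable V : nmodType.

Lemma sum_multiples (F : nat -> V) d N : (0 < d)%N ->
  \sum_(1 <= k < N.+1 | (d %| k)%N) F k = \sum_(1 <= m < (N %/ d).+1) F (d * m)%N.
Proof.
move=> d0; elim: N => [|N IH]; first by rewrite div0n !big_geq.
rewrite big_mkcond big_nat_recr //= -big_mkcond {}IH divnS //.
case: ifP => dN; last by rewrite addr0.
rewrite add1n [RHS]big_nat_recr //=; congr (_ + F _).
by rewrite -[X in _ = (d * X)%N]addn1 -[LHS](divnK dN) divnS // dN mulnC add1n addn1.
Qed.

Lemma sum_divisors (F : nat -> V) k N : (0 < k <= N)%N ->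
  \sum_(1 <= n < N.+1 | (n %| k)%N) F n = \sum_(1 <= n < k.+1 | (n %| k)%N) F n.
Proof.
move=> /andP[k0 kN]; rewrite (big_cat_nat _ (n := k.+1)) //=.
rewrite [X in _ + X]big_nat_cond [X in _ + X]big1 ?addr0 // => i /andP[/andP[ki _]].
by move/(dvdn_leq k0); rewrite leqNgt ki.
Qed.

(** Both sides run over the pairs [n], [m] with [n * m <= N]: grouped by the first factor on the
    left, by the product [k] on the right. *)
Lemma hyperbola (F : nat -> nat -> V) N :
  \sum_(1 <= n < N.+1) \sum_(1 <= m < (N %/ n).+1) F n (n * m)%N =
  \sum_(1 <= k < N.+1) \sum_(1 <= n < N.+1 | (n %| k)%N) F n k.
Proof.
rewrite (exchange_big_dep_nat predT) //=; apply: eq_big_nat => n /andP[n0 _].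
by rewrite (sum_multiples (F n)).
Qed.

Lemma sum_floor_swap (F : nat -> nat -> V) N :
  \sum_(1 <= n < N.+1) \sum_(1 <= m < (N %/ n).+1) F n m =
  \sum_(1 <= m < N.+1) \sum_(1 <= n < (N %/ m).+1) F n m.
Proof.
(* Extension by zero to the full square, where the order of summation can be changed. *)
pose G n m := if (n * m <= N)%N then F n m else 0.
have ext (H : nat -> V) n : (0 < n)%N ->
    \sum_(1 <= m < (N %/ n).+1) H m =
    \sum_(1 <= m < N.+1) if (n * m <= N)%N then H m else 0.
  move=> n0; have le : ((N %/ n).+1 <= N.+1)%N by rewrite ltnS leq_div.
  rewrite [RHS](big_cat_nat _ (n := (N %/ n).+1)) //= [X in _ = _ + X]big_nat [X in _ = _ + X]big1 ?addr0.
    by apply: eq_big_nat => m /andP[_]; rewrite ltnS leq_divRL // mulnC => ->.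
  by move=> m /andP[]; rewrite ltn_divLR // mulnC ltnNge => /negbTE ->.
transitivity (\sum_(1 <= n < N.+1) \sum_(1 <= m < N.+1) G n m).
  by apply: eq_big_nat => n /andP[n0 _]; rewrite ext.
rewrite exchange_big_nat; apply: eq_big_nat => m /andP[m0 _]; rewrite ext //.
by apply: eq_big_nat => n _; rewrite mulnC.
Qed.

End FloorSums.

(** * The von Mangoldt function *)

Section VonMangoldt.
Variable R : realType.
Implicit Types (n N d p : nat).

(** A sum over all representations of [n] as a prime power; there is at most one, and a sum can be
    exchanged with other sums. *)
Definition vonMangoldt n : R :=
  \sum_(1 <= p < n.+1 | prime p) \sum_(1 <= i < n.+1 | (p ^ i == n)%N) ln (p%:R : R).

Lemma ln_nat_ge0 n : 0 <= ln (n%:R : R).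
Proof.
case: n => [|n]; first by rewrite ln0.
by apply: ln_ge0; rewrite ler1n.
Qed.

Lemma vonMangoldt_ge0 n : 0 <= vonMangoldt n.
Proof. by do 2! (apply: sumr_ge0 => ? _); exact: ln_nat_ge0. Qed.

Lemma vonMangoldt_neq0 n : vonMangoldt n != 0 ->
  exists p i, [/\ prime p, (0 < i)%N & n = (p ^ i)%N].
Proof.
move=> nz; apply: contrapT => h; case/eqP: nz; apply: big1 => p pp.
rewrite big_nat_cond big1 // => i /andP[/andP[i0 _] /eqP ni].
by case: h; exists p, i; rewrite pp i0 -ni.
Qed.

(** A representation [p ^ i = n] has [p <= n] and [i < n], so larger ranges add only empty terms. *)
Lemma vonMangoldt_widen n N : (n <= N)%N -> vonMangoldt n =
  \sum_(1 <= p < N.+1 | prime p) \sum_(1 <= i < N.+1 | (p ^ i == n)%N) ln (p%:R : R).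
Proof.
move=> nN; rewrite [RHS](big_cat_nat _ (n := n.+1)) //= [X in _ = _ + X]big_nat_cond [X in _ = _ + X]big1 ?addr0.
  apply: eq_bigr => p pp; rewrite [RHS](big_cat_nat _ (n := n.+1)) //=.
  rewrite [X in _ = _ + X]big_nat_cond [X in _ = _ + X]big1 ?addr0 // => i /andP[/andP[ni _] /eqP pin].
  by move: (ltn_expl i (prime_gt1 pp)); rewrite pin => /ltnW; rewrite leqNgt ni.
move=> p /andP[/andP[np _] pp]; rewrite big_nat_cond big1 // => i /andP[/andP[i0 _] /eqP pin].
move: np; rewrite ltnNge -pin -[p in (p <= _)%N]expn1 leq_pexp2l //; exact: prime_gt0.
Qed.

Lemma ln_factor n : (0 < n)%N ->
  ln (n%:R : R) = \sum_(1 <= p < n.+1 | prime p) (logn p n)%:R * ln p%:R.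
Proof.
move=> n0; rewrite -[in LHS](partnT n0) /partn.
rewrite (big_mkcond (fun p => prime p)) big_ltn_cond //= mul1n.
rewrite (eq_bigl predT) //=.
elim: (n.+1) => [|m IH]; first by rewrite !big_geq // ln1.
case: m IH => [|m] IH; first by rewrite !big_geq // ln1.
rewrite big_nat_recr //= [RHS]big_nat_recr //= natrM lnM ?IH ?posrE ?ltr0n ?expn_gt0 ?prodn_gt0 //.
congr (_ + _); case: ifP => pm; last by rewrite lognE pm /= expn0 ln1.
by rewrite natrX lnXn ?ltr0n // mulr_natl.
Qed.

(** Every prime power [p ^ i] dividing [n] contributes [ln p], and for each [p] there are [logn p n]
    of them. *)
Lemma sum_vonMangoldt_dvd N n : (0 < n <= N)%N ->
  \sum_(1 <= d < N.+1 | (d %| n)%N) vonMangoldt d = ln n%:R.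
Proof.
move=> /andP[n0 nN]; rewrite sum_divisors ?n0 // ln_factor //.
pose G p i : R := if (p ^ i %| n)%N then ln p%:R else 0.
transitivity (\sum_(1 <= p < n.+1 | prime p) \sum_(1 <= i < n.+1) G p i).
  transitivity (\sum_(1 <= d < n.+1 | (d %| n)%N) \sum_(1 <= p < n.+1 | prime p)
      \sum_(1 <= i < n.+1 | (p ^ i == d)%N) (ln p%:R : R)).
    rewrite big_nat_cond [RHS]big_nat_cond; apply: eq_bigr => d /andP[/andP[_ dn] _].
    exact: vonMangoldt_widen.
  rewrite (exchange_big_dep_nat (fun p => prime p)) //=.
  apply: eq_bigr => p pp; rewrite (exchange_big_dep_nat predT) //=; apply: eq_big_nat => i /andP[i0 _].
  rewrite /G; case: ifP => pin.
    have pile : (p ^ i < n.+1)%N by rewrite ltnS dvdn_leq.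
    have pi0 : (0 < p ^ i)%N by rewrite expn_gt0 prime_gt0.
    rewrite big_mkcond (bigD1_seq (p ^ i)%N) /=; last 2 first.
    - by rewrite mem_index_iota pi0.
    - exact: iota_uniq.
    rewrite pp pin eqxx /= big1 ?addr0 // => d /negbTE; rewrite eq_sym => ->; by rewrite andbF.
  by rewrite big1 // => d /andP[/andP[dn _] /eqP pid]; rewrite pid dn in pin.
apply: eq_bigr => p pp; rewrite logn_count_dvd // natr_sum mulr_suml.
(* [logn_count_dvd] counts exponents below [n]; the extra exponent [n] gives nothing because
   [p ^ n > n]. *)
rewrite [LHS]big_nat_recr //= [X in _ + X]/G.
have -> : (p ^ n %| n)%N = false.
  by apply/negbTE; apply/negP => /(dvdn_leq n0); rewrite leqNgt ltn_expl // prime_gt1.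
by rewrite addr0; apply: eq_bigr => i _; rewrite /G; case: (_ %| _)%N; rewrite ?mul1r ?mul0r.
Qed.

End VonMangoldt.

(** * The Moebius function and its divisor sums *)

Section Moebius.
Variable R : realType.
Implicit Types (n N d p : nat).

Definition moebius n : R := \prod_(p <- primes n) (if logn p n == 1%N then -1 else 0).

Lemma normr_moebius n : `|moebius n| <= 1.
Proof.
rewrite /moebius; elim: (primes n) => [|p s IH]; first by rewrite big_nil normr1.
rewrite big_cons; case: ifP => _; last by rewrite mul0r normr0.
by rewrite normrM normrN1 mul1r.
Qed.

Lemma moebius1 : moebius 1 = 1.
Proof. by rewrite /moebius big_nil. Qed.

Lemma moebius_mul_prime p n : prime p -> (0 < n)%N ->
  moebius (p * n) = if (p %| n)%N then 0 else - moebius n.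
Proof.
move=> pp n0; have p0 := prime_gt0 pp.
have pin : p \in primes (p * n) by rewrite mem_primes pp muln_gt0 p0 n0 dvdn_mulr.
case: ifP => pn.
  rewrite /moebius (bigD1_seq p) ?primes_uniq //= lognM // logn_prime // eqxx.
  by rewrite -[X in _ == X]addn0 eqn_add2l lognE pp n0 pn /= mul0r.
have pNn : p \notin primes n by rewrite mem_primes pn !andbF.
have pe : perm_eq (primes (p * n)) (p :: primes n).
  apply: uniq_perm; rewrite /= ?pNn ?primes_uniq // => q.
  by rewrite primesM // in_cons primes_prime // mem_seq1.
rewrite /moebius (perm_big _ pe) big_cons lognM // logn_prime // eqxx.
rewrite (lognE p n) pp n0 pn /= mulN1r; congr (- _).
apply: eq_big_seq => q qn; rewrite lognM // logn_prime //.
by case: (eqVneq q p) => // qp; rewrite qp (negbTE pNn) in qn.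
Qed.

(* The squarefree divisors d and pd of n cancel, p being a prime factor of n. *)
Lemma sum_moebius_dvd N n : (0 < n <= N)%N ->
  \sum_(1 <= d < N.+1 | (d %| n)%N) moebius d = (n == 1%N)%:R.
Proof.
move=> /andP[n0 nN]; rewrite sum_divisors ?n0 //; case: eqP => [->|n1].
  by rewrite big_mkcond big_nat1 moebius1.
have {}n1 : (1 < n)%N by lia.
set p := pdiv n; have pp : prime p := pdiv_prime n1; have p0 := prime_gt0 pp.
have pn : (p %| n)%N := pdiv_dvd n.
rewrite (bigID (fun d => (p %| d)%N)) /=.
under eq_bigl => d do rewrite andbC.
rewrite big_mkcondr /= (sum_multiples (fun d => if (d %| n)%N then moebius d else 0)) //.
rewrite (eq_big_nat _ _ (F2 := fun m => if (m %| n)%N && ~~ (p %| m)%N then - moebius m else 0)).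
  rewrite -big_mkcond /= sumrN [X in _ + X](big_cat_nat _ (n := (n %/ p).+1)) //=; last first.
    by rewrite ltnS leq_div.
  rewrite [X in _ + (_ + X)]big_nat_cond [X in _ + (_ + X)]big1 ?addr0 ?addNr //.
  move=> d /andP[/andP[dl _] /andP[dn pd]].
  have : (p * d %| n)%N by rewrite Gauss_dvd ?pn // prime_coprime.
  by move/(dvdn_leq n0); rewrite mulnC -leq_divRL // leqNgt dl.
move=> m /andP[m0 _]; rewrite moebius_mul_prime //.
case: (boolP (p %| m)%N) => pm; rewrite ?andbF ?andbT; first by case: ifP.
by rewrite Gauss_dvd ?pn // prime_coprime.
Qed.

(** With [ln d = ln n - ln (n %/ d)], the first part vanishes by [sum_moebius_dvd] and the second is
    the Moebius inversion of [sum_vonMangoldt_dvd]. *)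
Lemma sum_moebius_ln_dvd N n : (0 < n <= N)%N ->
  \sum_(1 <= d < N.+1 | (d %| n)%N) moebius d * ln d%:R = - vonMangoldt R n.
Proof.
move=> /andP[n0 nN]; rewrite sum_divisors ?n0 //.
have E d : (0 < d)%N -> (d %| n)%N -> ln (d%:R : R) = ln n%:R - ln (n %/ d)%:R.
  move=> d0 dn; have q0 : (0 < n %/ d)%N by rewrite divn_gt0 // dvdn_leq.
  rewrite -[in ln n%:R](divnK dn) natrM lnM ?posrE ?ltr0n //; ring.
transitivity (\sum_(1 <= d < n.+1 | (d %| n)%N) moebius d * ln n%:R
   - \sum_(1 <= d < n.+1 | (d %| n)%N) moebius d * ln (n %/ d)%:R).
  rewrite -sumrB big_nat_cond [RHS]big_nat_cond; apply: eq_bigr => d /andP[/andP[d0 _] dn].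
  by rewrite (E d) // mulrBr.
rewrite -mulr_suml sum_moebius_dvd ?n0 ?leqnn //.
have -> : (n == 1%N)%:R * ln (n%:R : R) = 0 by case: eqP => [->|_]; rewrite ?ln1 ?mul0r ?mulr0.
rewrite sub0r; congr (- _).
transitivity (\sum_(1 <= d < n.+1) \sum_(1 <= e < n.+1 | (d * e %| n)%N) moebius d * vonMangoldt R e).
  rewrite big_mkcond; apply: eq_big_nat => d /andP[d0 dn].
  case: ifP => dvd; last first.
    rewrite big1 // => e h; move: dvd; by rewrite (dvdn_trans _ h) // dvdn_mulr.
  have q0 : (0 < n %/ d)%N by rewrite divn_gt0 // dvdn_leq.
  rewrite -(@sum_vonMangoldt_dvd R n (n %/ d)%N) ?q0 ?leq_div //.
  rewrite mulr_sumr; apply: eq_bigl => e; by rewrite dvdn_divRL // mulnC.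
rewrite (exchange_big_dep_nat predT) //=.
(* The inner sum over the divisors [d] of [n %/ e] is zero unless [e = n]. *)
rewrite (eq_big_nat _ _ (F2 := fun e => if e == n then vonMangoldt R e else 0)).
  rewrite big_nat_recr //= eqxx big_nat [X in X + _]big1 ?add0r //.
  by move=> e /andP[_ en]; rewrite ltn_eqF.
move=> e /andP[e0 en]; rewrite -mulr_suml.
case: (boolP (e %| n)%N) => h; last first.
  rewrite big1 ?mul0r; last by move=> d h2; case/negP: h; rewrite (dvdn_trans _ h2) // dvdn_mull.
  by case: eqP h => // ->; rewrite dvdnn.
have q0 : (0 < n %/ e)%N by rewrite divn_gt0 // dvdn_leq.
rewrite (eq_bigl (fun d => (d %| n %/ e)%N)); last by move=> d; rewrite dvdn_divRL.
rewrite sum_moebius_dvd ?q0 ?leq_div //.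
case: (eqVneq e n) => [->|ne]; first by rewrite divnn n0 mul1r.
have -> : (n %/ e == 1)%N = false; last by rewrite mul0r.
by apply/negbTE; apply: contraNneq ne => h1; rewrite -(divnK h) h1 mul1n.
Qed.

End Moebius.

(** * Elementary estimates for logarithmic and harmonic sums *)

Section LogSums.
Variable R : realType.
Implicit Types (n N d m : nat) (x y : R).

Lemma ln_le_sub1 x : 0 < x -> ln x <= x - 1.
Proof.
move=> x0; have {1}-> : x = 1 + (x - 1) by ring.
by apply: le_ln1Dx; lra.
Qed.

Lemma ln_ge_1subV x : 0 < x -> 1 - x^-1 <= ln x.
Proof.
move=> x0; have := @ln_le_sub1 x^-1; rewrite invr_gt0 lnV ?posrE // => /(_ x0); lra.
Qed.

Lemma ler_ln_nat m n : (m <= n)%N -> ln (m%:R : R) <= ln n%:R.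
Proof.
case: m => [|m] mn; first by rewrite ln0 // ln_nat_ge0.
by rewrite ler_ln ?posrE ?ltr0n ?ler_nat //; lia.
Qed.

Lemma ln_nat_le n : ln (n%:R : R) <= n%:R.
Proof.
case: n => [|n]; first by rewrite ln0.
by apply: ltW; apply: ln_sublinear; rewrite ltr0n.
Qed.

Lemma ln_succ_bounds n : (0 < n)%N ->
  n.+1%:R^-1 <= ln (n.+1%:R : R) - ln n%:R <= n%:R^-1.
Proof.
move=> n0; have p : (0 : R) < n%:R by rewrite ltr0n.
have q : (0 : R) < n.+1%:R by rewrite ltr0n.
rewrite -ln_div ?posrE //; apply/andP; split.
  apply: le_trans (ln_ge_1subV _); last exact: divr_gt0.
  rewrite invf_div -natr1 le_eqVlt; apply/orP; left; apply/eqP; field.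
  by rewrite natr1 lt0r_neq0.
apply: le_trans (ln_le_sub1 _) _; first exact: divr_gt0.
rewrite -natr1 le_eqVlt; apply/orP; left; apply/eqP; field; exact: lt0r_neq0.
Qed.

Lemma floor_bounds N d : (0 < d)%N ->
  (N %/ d)%:R <= (N%:R / d%:R : R) < (N %/ d)%:R + 1.
Proof.
move=> d0; have p : (0 : R) < d%:R by rewrite ltr0n.
rewrite ler_pdivlMr // ltr_pdivrMr // -natrM ler_nat leq_divM /=.
by rewrite natr1 -natrM ltr_nat -ltn_divLR.
Qed.

(** A weak Stirling formula, by induction from [ln_succ_bounds]. *)
Lemma sum_ln_bounds N : (0 < N)%N ->
  N%:R * ln N%:R - N%:R <= \sum_(1 <= m < N.+1) ln (m%:R : R)
    <= N%:R * ln N%:R - N%:R + 1 + ln N%:R.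
Proof.
case: N => // N _; elim: N => [|N IH]; first by rewrite big_nat1 ln1; apply/andP; lra.
rewrite big_nat_recr //=.
have /andP[] := @ln_succ_bounds N.+1 isT.
have p : (0 : R) < N.+1%:R by rewrite ltr0n.
have q : (0 : R) < N.+2%:R by rewrite ltr0n.
rewrite -[_ <= ln _ - _](ler_pM2l q) -[ln _ - _ <= _](ler_pM2l p) !mulfV ?lt0r_neq0 //.
move: IH => /andP[]; rewrite -[N.+2%:R]natr1.
set l := ln _; set s := \sum_(1 <= _ < _) _; set k := ln _; set n := N.+1%:R => *.
by apply/andP; lra.
Qed.

(** The corresponding integral over [(0, N]] is [5 * N]. The proof is an induction: raising [ln N]
    by [e] adds terms linear in [ln d], which [sum_ln_bounds] controls. *)
Lemma sum_sqr_ln_le N :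
  \sum_(1 <= d < N.+1) (1 + (ln (N%:R : R) - ln d%:R)) ^+ 2 <= 6 * N%:R.
Proof.
case: N => [|N]; first by rewrite big_geq // mulr0.
elim: N => [|N IH]; first by rewrite big_nat1 ln1 subr0 addr0 expr1n; lra.
rewrite big_nat_recr //=.
set e := ln (N.+2%:R : R) - ln N.+1%:R.
have /andP[e0 e1] := @ln_succ_bounds N.+1 isT; rewrite -/e in e0 e1.
have p : (1 : R) <= N.+1%:R by rewrite ler1n.
have e2 : e * N.+1%:R <= 1.
  by move: e1; rewrite -ler_pdivlMr ?div1r //; lra.
have e3 : 0 <= e by apply: le_trans e0; rewrite invr_ge0.
rewrite (eq_bigr (fun d => (1 + (ln (N.+1%:R : R) - ln d%:R)) ^+ 2
   + (2 * e + e ^+ 2 + 2 * e * ln N.+1%:R - 2 * e * ln d%:R))); last first.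
  by move=> d _; rewrite /e; ring.
rewrite big_split /= sumrB -mulr_sumr sumr_const_nat subn1 /= subrr addr0 expr1n.
have /andP[+ _] := @sum_ln_bounds N.+1 isT.
move: IH; set S := \sum_(1 <= _ < _) _; set T := \sum_(1 <= _ < _) _ => IH hT.
rewrite -[_ *+ N.+1]mulr_natl.
move: IH p e2 hT; rewrite -[N.+2%:R]natr1; set n := N.+1%:R; set l := ln _ => IH p e2 hT.
have : e * (n * l - n) <= e * T by rewrite ler_wpM2l.
have : e <= 1 by nra.
nra.
Qed.

(** [g] is Euler's constant. The sequences [a N] and [a N - 1 / N] are monotone in opposite
    directions and enclose it, which gives the error [1 / N]. *)
Lemma harmonic_euler : exists2 g : R, 0 <= g <= 1 & forall N, (0 < N)%N ->
  ln N%:R + g <= \sum_(1 <= n < N.+1) n%:R^-1 <= ln N%:R + g + N%:R^-1.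
Proof.
pose a N : R := \sum_(1 <= n < N.+1) n%:R^-1 - ln N%:R.
have a1 : a 1%N = 1 by rewrite /a big_nat1 ln1 invr1 subr0.
have aS N : (0 < N)%N -> a N.+1 = a N + N.+1%:R^-1 - (ln N.+1%:R - ln N%:R).
  by move=> N0; rewrite /a big_nat_recr //=; set i := N.+1%:R^-1; ring.
have dec N : (0 < N)%N -> a N.+1 <= a N.
  move=> N0; rewrite aS //; have /andP[] := ln_succ_bounds N0.
  by set i := N.+1%:R^-1; set j := N%:R^-1 => *; lra.
have inc N : (0 < N)%N -> a N - N%:R^-1 <= a N.+1 - N.+1%:R^-1.
  move=> N0; rewrite aS //; have /andP[] := ln_succ_bounds N0.
  by set i := N.+1%:R^-1; set j := N%:R^-1 => *; lra.
have decD N k : (0 < N)%N -> a (N + k)%N <= a N.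
  move=> N0; elim: k => [|k IH]; first by rewrite addn0.
  by rewrite addnS (le_trans (dec _ _)) ?addn_gt0 ?N0.
have incD N k : (0 < N)%N -> a N - N%:R^-1 <= a (N + k)%N - (N + k)%:R^-1.
  move=> N0; elim: k => [|k IH]; first by rewrite addn0.
  by rewrite addnS (le_trans _ (inc _ _)) ?addn_gt0 ?N0.
have cross N M : (0 < N)%N -> (0 < M)%N -> a N - N%:R^-1 <= a M.
  move=> N0 M0; have := incD N M N0; have := decD M N M0; rewrite addnC.
  have : (0 : R) <= (N + M)%:R^-1 by rewrite invr_ge0.
  by set i := N%:R^-1; set j := (N + M)%:R^-1 => *; lra.
pose E : set R := [set x | exists2 N, (0 < N)%N & x = a N]%classic.
have E0 : has_inf E.
  split; first by exists (a 1%N); exists 1%N.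
  by exists (a 1%N - 1%:R^-1) => x [N N0 ->]; exact: cross.
have lb N : (0 < N)%N -> inf E <= a N.
  by move=> N0; apply: ge_inf; [case: E0 | exists N].
have ub N : (0 < N)%N -> a N - N%:R^-1 <= inf E.
  move=> N0; apply: lb_le_inf; first by case: E0.
  by move=> x [M M0 ->]; exact: cross.
exists (inf E).
  by have := lb 1%N isT; have := ub 1%N isT; rewrite a1 invr1 => *; apply/andP; split; lra.
move=> N N0; have := lb N N0; have := ub N N0; rewrite /a.
by set i := N%:R^-1 => *; apply/andP; split; lra.
Qed.

Lemma sum_inv_range V W : (0 < V <= W)%N ->
  `|\sum_(V.+1 <= n < W.+1) n%:R^-1 - (ln W%:R - ln (V%:R : R))| <= 1.
Proof.
move=> /andP[V0 VW]; have W0 := leq_trans V0 VW; have [g _ hg] := harmonic_euler.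
have /andP[a1 a2] := hg V V0; have /andP[] := hg W W0.
rewrite (big_cat_nat _ (n := V.+1)) //=; move: a1 a2.
have iV : (V%:R^-1 : R) <= 1 by rewrite invf_le1 ?ltr0n // ler1n.
have iW : (W%:R^-1 : R) <= 1 by rewrite invf_le1 ?ltr0n // ler1n.
move: iV iW; set i := V%:R^-1; set j := W%:R^-1.
set s := \sum_(1 <= _ < _) _; set u := \sum_(V.+1 <= _ < _) _ => *.
by rewrite ler_norml; apply/andP; split; lra.
Qed.

End LogSums.

(** * Estimates of Chebyshev and Mertens *)

Section Chebyshev.
Variable R : realType.
Implicit Types (n N d m u v K : nat).

Local Notation Lam := (vonMangoldt R).

Definition chebyshev_psi N : R := \sum_(1 <= n < N.+1) Lam n.

Local Notation psi := chebyshev_psi.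

Lemma psiS N : psi N.+1 = psi N + Lam N.+1.
Proof. by rewrite /chebyshev_psi big_nat_recr. Qed.

Lemma vonMangoldt1 : Lam 1 = 0.
Proof. by rewrite /vonMangoldt big_mkcond big_nat1. Qed.

Lemma psi0 : psi 0 = 0.
Proof. by rewrite /chebyshev_psi big_geq. Qed.

Lemma psi1 : psi 1 = 0.
Proof. by rewrite psiS psi0 vonMangoldt1 addr0. Qed.

Lemma psi_ge0 N : 0 <= psi N.
Proof. by apply: sumr_ge0 => n _; exact: vonMangoldt_ge0. Qed.

Lemma psi_cat m n : (m <= n)%N -> psi n = psi m + \sum_(m.+1 <= k < n.+1) Lam k.
Proof. by move=> mn; rewrite /chebyshev_psi (big_cat_nat _ (n := m.+1)). Qed.

Lemma ler_psi m n : (m <= n)%N -> psi m <= psi n.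
Proof.
move=> mn; rewrite (psi_cat mn) lerDl; apply: sumr_ge0 => k _; exact: vonMangoldt_ge0.
Qed.

(** Both sides sum [Lam m] over the products [n * m <= N], since [ln k] is the sum of [Lam] over the
    divisors of [k]. *)
Lemma sum_psi_floor N :
  \sum_(1 <= n < N.+1) psi (N %/ n) = \sum_(1 <= m < N.+1) ln m%:R.
Proof.
rewrite /chebyshev_psi (sum_floor_swap (fun _ m => Lam m)) (hyperbola (fun n _ => Lam n)).
by apply: eq_big_nat => k k_range; rewrite sum_vonMangoldt_dvd.
Qed.

Lemma sum_vonMangoldt_floor N :
  \sum_(1 <= n < N.+1) Lam n * (N %/ n)%:R = \sum_(1 <= m < N.+1) ln m%:R.
Proof.
rewrite -sum_psi_floor /psi (sum_floor_swap (fun _ m => Lam m)).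
by apply: eq_bigr => n _; rewrite sumr_const_nat subn1 /= mulr_natr.
Qed.

(** Chebyshev's argument: on the right [Lam n] has the coefficient [N %/ n - 2 * (N./2 %/ n)], which
    is nonnegative, and at least 1 for [N./2 < n <= N]. *)
Lemma psi_half_le N : psi N - psi N./2 <=
  \sum_(1 <= m < N.+1) ln m%:R - 2 * \sum_(1 <= m < N./2.+1) ln m%:R.
Proof.
have hN : (N./2 <= N)%N by lia.
have E : \sum_(1 <= m < N./2.+1) ln (m%:R : R) = \sum_(1 <= n < N.+1) Lam n * (N./2 %/ n)%:R.
  rewrite -sum_vonMangoldt_floor [RHS](big_cat_nat _ (n := N./2.+1)) //=.
  rewrite [X in _ = _ + X]big_nat [X in _ = _ + X]big1 ?addr0 // => n /andP[hn _].
  by rewrite divn_small ?mulr0.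
rewrite E -sum_vonMangoldt_floor (psi_cat hN) addrAC subrr add0r mulr_sumr -sumrB.
rewrite [X in _ <= X](big_cat_nat _ (n := N./2.+1)) //=.
rewrite -[X in X <= _]add0r; apply: lerD.
  apply: sumr_ge0 => n _.
  have -> : Lam n * (N %/ n)%:R - 2 * (Lam n * (N./2 %/ n)%:R) =
     Lam n * ((N %/ n)%:R - (2 * (N./2 %/ n))%:R) by rewrite natrM; ring.
  apply: mulr_ge0; first exact: vonMangoldt_ge0.
  rewrite subr_ge0 ler_nat; case: n => [|n]; first by rewrite !divn0.
  rewrite leq_divRL // -mulnA (leq_trans (n := 2 * N./2)) //.
    by rewrite leq_mul2l leq_divM.
  by rewrite mul2n -geq_half_double.
rewrite big_nat [X in _ <= X]big_nat; apply: ler_sum => n /andP[hn nN].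
rewrite (divn_small hn) mulr0 mulr0 subr0 ler_peMr ?vonMangoldt_ge0 //.
by rewrite ler1n divn_gt0 // (leq_trans _ hn).
Qed.

(** Strong induction along halving by [psi_half_le]. The constant is generous because the
    logarithmic terms are absorbed by [ln N <= N]. *)
Lemma psi_le N : psi N <= 10 * N%:R.
Proof.
elim/ltn_ind: N => N IH.
case: (leqP N 1) => [N1|N1].
  have -> : psi N = 0 by case: N N1 {IH} => [|[|]] // _; rewrite ?psi0 ?psi1.
  by rewrite mulr_ge0.
have h0 : (0 < N./2)%N by rewrite half_gt0.
have /IH : (N./2 < N)%N by lia.
have := psi_half_le N.
have /andP[_] := @sum_ln_bounds R N (ltnW N1).
have /andP[+ _] := @sum_ln_bounds R N./2 h0.
have NE : (N%:R : R) = (odd N)%:R + 2 * N./2%:R by rewrite -natrM -natrD mul2n odd_double_half.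
have N0 : (0 : R) < N%:R by rewrite ltr0n ltnW.
have hh : (1 : R) <= N./2%:R by rewrite ler1n.
(* For odd [N] the quotient can exceed 2, but it is at most 3. *)
have l3 : ln (N%:R : R) - ln N./2%:R <= 2.
  rewrite -ln_div ?posrE ?ltr0n ?(ltnW N1) //.
  have q0 : (0 : R) < N%:R / N./2%:R by apply: divr_gt0; lra.
  apply: le_trans (ln_le_sub1 q0) _.
  rewrite lerBlDr ler_pdivrMr; last by lra.
  rewrite NE; case: (odd N) => /=; lra.
have lN := @ln_nat_le R N.
have l0 := @ln_nat_ge0 R N.
have hl3 : N./2%:R * (ln (N%:R : R) - ln N./2%:R) <= N./2%:R * 2 by rewrite ler_wpM2l.
set T := \sum_(_ <= _ < _) _; set U := \sum_(_ <= _ < _) _.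
move: NE lN l0 hl3 {l3}; set l := ln _; set k := ln _; set h := N./2%:R; set n := N%:R.
move=> NE lN l0 hl3.
have : n * l <= 2 * (h * l) + l.
  by rewrite NE; case: (odd N) => /=; lra.
have : 2 * h <= n by rewrite NE lerDr ler0n.
lra.
Qed.

(** Division of [sum_vonMangoldt_floor] by [N]: replacing each [N %/ n] by the exact quotient costs
    at most [psi N] in total. *)
Lemma mertens N : (0 < N)%N ->
  ln N%:R - 1 <= \sum_(1 <= n < N.+1) Lam n / n%:R <= ln N%:R + 10.
Proof.
move=> N0; have n0 : (0 : R) < N%:R by rewrite ltr0n.
have /andP[] := @sum_ln_bounds R N N0; rewrite -sum_vonMangoldt_floor.
have : \sum_(1 <= n < N.+1) Lam n * (N %/ n)%:R <= N%:R * (\sum_(1 <= n < N.+1) Lam n / n%:R)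
       <= \sum_(1 <= n < N.+1) Lam n * (N %/ n)%:R + psi N.
  rewrite mulr_sumr /psi -big_split /=; apply/andP; split; rewrite big_nat [X in _ <= X]big_nat;
  apply: ler_sum => n /andP[n1 _]; have /andP[h1 h2] := @floor_bounds R N n n1;
  rewrite mulrCA.
    by rewrite ler_wpM2l ?vonMangoldt_ge0.
  by rewrite -[X in _ <= _ + X]mulr1 -mulrDr ler_wpM2l ?vonMangoldt_ge0 // ltW.
have := psi_le N.
have : ln (N%:R : R) <= N%:R - 1 by apply: ln_le_sub1.
set s := \sum_(_ <= _ < _) _; set t := \sum_(_ <= _ < _) _; set l := ln _; set n := N%:R.
move=> h1 h2 /andP[h3 h4] h5 h6.
rewrite -(ler_pM2l n0) -[t <= _](ler_pM2l n0) -/n; apply/andP; split; lra.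
Qed.

(** Partial summation as an induction: from [N] to [N + 1] the sum grows by
    [psi N * (ln (N + 1) - ln N)], which Chebyshev bounds by 10. *)
Lemma sum_vonMangoldt_ln_le N :
  0 <= \sum_(1 <= n < N.+1) Lam n * (ln N%:R - ln n%:R) <= 10 * N%:R.
Proof.
case: N => [|N]; first by rewrite big_geq // mulr0 lexx.
elim: N => [|N IH]; first by rewrite big_nat1 subrr mulr0; apply/andP; lra.
rewrite big_nat_recr //= subrr mulr0 addr0.
have -> : \sum_(1 <= i < N.+2) Lam i * (ln N.+2%:R - ln i%:R) =
  \sum_(1 <= i < N.+2) Lam i * (ln N.+1%:R - ln i%:R) + psi N.+1 * (ln N.+2%:R - ln N.+1%:R).
  rewrite /chebyshev_psi mulr_suml -big_split /=; apply: eq_bigr => i _; ring.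
have /andP[e0 e1] := @ln_succ_bounds R N.+1 isT.
have p : (0 : R) < N.+1%:R by rewrite ltr0n.
have e3 : 0 <= ln (N.+2%:R : R) - ln N.+1%:R by apply: le_trans e0; rewrite invr_ge0.
have : psi N.+1 * (ln (N.+2%:R : R) - ln N.+1%:R) <= (10 * N.+1%:R) * N.+1%:R^-1.
  by apply: ler_pM => //; [exact: psi_ge0 | exact: psi_le].
rewrite mulfK ?lt0r_neq0 // => h.
have : 0 <= psi N.+1 * (ln (N.+2%:R : R) - ln N.+1%:R) by rewrite mulr_ge0 ?psi_ge0.
move: h IH => + /andP[]; rewrite -[N.+2%:R]natr1.
set s := \sum_(_ <= _ < _) _; set t := psi _ * _; set n := N.+1%:R => *; apply/andP; lra.
Qed.

End Chebyshev.

(** * Selberg's symmetry formula and its consequences *)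

Section Selberg.
Variable R : realType.
Implicit Types (n N d m u v K : nat).

Local Notation Lam := (vonMangoldt R).
Local Notation psi := (@chebyshev_psi R).
Local Notation mu := (@moebius R).

(** Grouping by [k = d * m], the two Moebius sums give [f k] the coefficient [ln N] at [k = 1] plus
    [Lam k]. *)
Lemma tatuzawa_iseki (f : nat -> R) N : (0 < N)%N ->
  \sum_(1 <= d < N.+1) (mu d * (ln N%:R - ln d%:R)) * \sum_(1 <= m < (N %/ d).+1) f (d * m)%N =
  f 1%N * ln N%:R + \sum_(1 <= k < N.+1) Lam k * f k.
Proof.
move=> N0; under eq_bigr => d _ do rewrite mulr_sumr.
rewrite (hyperbola (fun d k => mu d * (ln N%:R - ln d%:R) * f k)).
transitivity (\sum_(1 <= k < N.+1) ((k == 1%N)%:R * (f 1%N * ln N%:R) + Lam k * f k)).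
  apply: eq_big_nat => k k_range; rewrite -mulr_suml.
  under eq_bigr => d _ do rewrite mulrBr.
  rewrite sumrB -mulr_suml sum_moebius_dvd // sum_moebius_ln_dvd // opprK mulrDl.
  by congr (_ + _); case: eqP => [->|]; rewrite ?mul0r // !mul1r mulrC.
rewrite big_split /= big_ltn // eqxx mul1r big_nat big1 ?addr0 // => k /andP[k1 _].
by rewrite gtn_eqF ?mul0r.
Qed.

(* The auxiliary function is chosen so that its sums over multiples are only
   logarithmically large: the main terms of [ln D`!] and of the harmonic sum cancel. *)
Lemma sum_psi_sub_bound g N d : 0 <= g <= 1 ->
  (forall N, (0 < N)%N -> ln N%:R + g <= \sum_(1 <= n < N.+1) n%:R^-1 <= ln N%:R + g + (N%:R^-1 : R)) ->
  (0 < d <= N)%N ->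
  `|\sum_(1 <= m < (N %/ d).+1) (psi (N %/ (d * m)) - N%:R / (d * m)%:R + (1 + g))|
    <= 3 * (1 + (ln N%:R - ln d%:R)).
Proof.
move=> /andP[g0 g1] hg /andP[d0 dN].
set D := (N %/ d)%N; have D0 : (0 < D)%N by rewrite divn_gt0.
have dp : (0 : R) < d%:R by rewrite ltr0n.
have Np : (0 : R) < N%:R by rewrite ltr0n (leq_trans d0).
have Dp : (1 : R) <= D%:R by rewrite ler1n.
have /andP[x0 x1] := @floor_bounds R N d d0; rewrite -/D in x0 x1.
set x : R := N%:R / d%:R in x0 x1 *.
rewrite big_split sumrB /= sumr_const_nat subn1 /=.
have -> : \sum_(1 <= m < D.+1) psi (N %/ (d * m)) = \sum_(1 <= m < D.+1) ln m%:R.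
  by rewrite -sum_psi_floor; apply: eq_bigr => m _; rewrite divnMA.
have -> : \sum_(1 <= m < D.+1) N%:R / (d * m)%:R = x * \sum_(1 <= m < D.+1) m%:R^-1.
  by rewrite mulr_sumr; apply: eq_bigr => m _; rewrite natrM invfM mulrA.
have /andP[s0 s1] := @sum_ln_bounds R D D0.
have /andP[h0 h1] := hg D D0.
have lx : ln D%:R <= ln (N%:R : R) - ln d%:R.
  by rewrite -ln_div ?posrE // ler_ln ?posrE ?divr_gt0 // (lt_le_trans _ Dp).
have l0 := @ln_nat_ge0 R D.
have xi : x * D%:R^-1 <= 2 by rewrite ler_pdivrMr; lra.
have {}h0 : x * (ln D%:R + g) <= x * \sum_(1 <= m < D.+1) m%:R^-1 by rewrite ler_wpM2l //; lra.
have {}h1 : x * \sum_(1 <= m < D.+1) m%:R^-1 <= x * (ln D%:R + g) + x * D%:R^-1.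
  by rewrite -mulrDr ler_wpM2l //; lra.
have e1 : 0 <= (x - D%:R) * ln D%:R <= ln D%:R by apply/andP; split; nra.
have e2 : 0 <= (x - D%:R) * g <= 1 by apply/andP; split; nra.
rewrite -[_ *+ D]mulr_natr.
move: lx s0 s1 h0 h1 xi l0 e1 e2 => + + + + + + + /andP[+ +] /andP[+ +].
set l := ln D%:R; set s := \sum_(_ <= _ < _) ln _; set h := x * \sum_(_ <= _ < _) _.
set z := _ * _^-1 => *.
rewrite ler_norml; apply/andP; split; lra.
Qed.

Definition selberg_sum N : R :=
  psi N * ln N%:R + \sum_(1 <= n < N.+1) Lam n * psi (N %/ n).

(** [tatuzawa_iseki] is applied to the function of [sum_psi_sub_bound]. The left side is at most
    [18 * N] by [sum_sqr_ln_le]; on the right, the value at 1 and Mertens' theorem each supply one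
    [N * ln N]. *)
Lemma selberg N : (0 < N)%N ->
  2 * N%:R * ln N%:R - 41 * N%:R <= selberg_sum N <= 2 * N%:R * ln N%:R + 41 * N%:R.
Proof.
move=> N0; have [g g01 hg] := @harmonic_euler R; have /andP[g0 g1] := g01.
have := @tatuzawa_iseki (fun k => psi (N %/ k) - N%:R / k%:R + (1 + g)) N N0.
set X := (X in X = _ -> _) => XE.
have : `|X| <= 18 * N%:R.
  apply: le_trans (ler_norm_sum _ _ _) _.
  apply: (@le_trans _ _ (\sum_(1 <= d < N.+1) 3 * (1 + (ln (N%:R : R) - ln d%:R)) ^+ 2)).
    rewrite big_nat [X in _ <= X]big_nat; apply: ler_sum => d /andP[d0 dN].
    rewrite !normrM; have := @sum_psi_sub_bound g N d g01 hg; rewrite d0 -ltnS dN => /(_ isT).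
    have := normr_moebius R d.
    have lp : 0 <= ln (N%:R : R) - ln d%:R by rewrite subr_ge0 ler_ln_nat.
    rewrite (ger0_norm lp); move: lp.
    set y := _ - _; set w := `|mu d|; have : 0 <= w by rewrite normr_ge0.
    set t := `|_| => w0 y0 w1 h.
    have t0 : 0 <= t by rewrite normr_ge0.
    apply: (@le_trans _ _ (y * t)); last by nra.
    by rewrite ler_wpM2r // ler_piMl.
  by rewrite -mulr_sumr; have := @sum_sqr_ln_le R N; lra.
rewrite ler_norml => /andP[]; rewrite {}XE {X}.
have -> : \sum_(1 <= k < N.+1) Lam k * (psi (N %/ k) - N%:R / k%:R + (1 + g)) =
   \sum_(1 <= k < N.+1) Lam k * psi (N %/ k) - N%:R * (\sum_(1 <= k < N.+1) Lam k / k%:R)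
   + (1 + g) * psi N.
  rewrite /chebyshev_psi !mulr_sumr -sumrB -big_split /=; apply: eq_bigr => k _; ring.
rewrite divn1 divr1 /selberg_sum.
have := psi_le R N; have := psi_ge0 R N.
have /andP[] := mertens R N0.
have := @ln_nat_le R N; have := @ln_nat_ge0 R N.
have np : (0 : R) < N%:R by rewrite ltr0n.
set M := \sum_(_ <= _ < _) _ / _; set S := \sum_(_ <= _ < _) _ * psi _.
set l := ln _; set p := psi N; set n := N%:R => l0 ln m0 m1 p0 p1 h1 h2.
have {}m0 : n * (l - 1) <= n * M by rewrite ler_pM2l.
have {}m1 : n * M <= n * (l + 10) by rewrite ler_pM2l.
have gp : 0 <= g * p <= p by apply/andP; split; nra.
have gl : 0 <= g * l <= l by apply/andP; split; nra.
move: gp gl => /andP[? ?] /andP[? ?].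
apply/andP; split; lra.
Qed.

(** Selberg's formula at [v] minus that at [u], the nonnegative difference of the convolution sums
    being dropped: at most twice the expected number of primes in a short interval. *)
Lemma psi_short_le u v : (0 < u <= v)%N ->
  (psi v - psi u) * ln v%:R <= 2 * (v%:R - u%:R) * ln v%:R + 84 * v%:R.
Proof.
move=> /andP[u0 uv]; have v0 := leq_trans u0 uv.
have /andP[+ _] := selberg u0; have /andP[_] := selberg v0; rewrite /selberg_sum.
have : \sum_(1 <= n < u.+1) Lam n * psi (u %/ n) <= \sum_(1 <= n < v.+1) Lam n * psi (v %/ n).
  rewrite [X in _ <= X](big_cat_nat _ (n := u.+1)) //=.
  rewrite -[X in X <= _]addr0; apply: lerD.
    by apply: ler_sum => n _; rewrite ler_wpM2l ?vonMangoldt_ge0 // ler_psi // leq_div2r.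
  by apply: sumr_ge0 => n _; rewrite mulr_ge0 ?vonMangoldt_ge0 ?psi_ge0.
have up : (0 : R) < u%:R by rewrite ltr0n.
have vp : (0 : R) < v%:R by rewrite ltr0n.
have uvr : (u%:R : R) <= v%:R by rewrite ler_nat.
have : u%:R * (ln (v%:R : R) - ln u%:R) <= v%:R - u%:R.
  rewrite -ln_div ?posrE // -ler_pdivlMl //.
  have := @ln_le_sub1 R (v%:R / u%:R) (divr_gt0 vp up).
  by rewrite mulrBr mulVf ?lt0r_neq0 // [_^-1 * _]mulrC.
have : psi u * ln u%:R <= psi u * ln v%:R by rewrite ler_wpM2l ?psi_ge0 // ler_ln_nat.
set S := \sum_(_ <= _ < _) _; set T := \sum_(_ <= _ < _) _.
move=> *; lra.
Qed.

(** Summing over [m] first gives [Lam m] the weight [minn K (N %/ m)]. Up to [D = N %/ K] this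
    amounts to [K * psi D = O(N)]; beyond [D], Mertens' theorem gives [N * (ln N - ln D)], that is
    [N * ln K] up to [O(N)]. *)
Lemma sum_psi_floor_range N K : (0 < K <= N)%N ->
  N%:R * ln K%:R - 22 * N%:R <= \sum_(1 <= n < K.+1) psi (N %/ n)
    <= N%:R * ln K%:R + 22 * N%:R.
Proof.
move=> /andP[K0 KN]; have N0 := leq_trans K0 KN.
have E : \sum_(1 <= n < K.+1) psi (N %/ n) =
    \sum_(1 <= m < N.+1) Lam m * (minn K (N %/ m))%:R.
  transitivity (\sum_(1 <= n < N.+1) \sum_(1 <= m < (N %/ n).+1) if (n <= K)%N then Lam m else 0).
    rewrite [RHS](big_cat_nat _ (n := K.+1)) //=.
    rewrite [X in _ = _ + X]big_nat [X in _ = _ + X]big1 ?addr0.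
      by apply: eq_big_nat => n /andP[_ nK]; apply: eq_bigr => m _; rewrite -ltnS nK.
    by move=> n /andP[Kn _]; rewrite big1 // => m _; rewrite leqNgt Kn.
  rewrite sum_floor_swap; apply: eq_big_nat => m _.
  have -> : Lam m * (minn K (N %/ m))%:R = \sum_(1 <= n < (minn K (N %/ m)).+1) Lam m.
    by rewrite sumr_const_nat subn1 mulr_natr.
  have hm : (minn K (N %/ m) <= N %/ m)%N by exact: geq_minr.
  rewrite (big_cat_nat _ (n := (minn K (N %/ m)).+1)) //=.
  rewrite [X in _ + X]big_nat [X in _ + X]big1 ?addr0.
    rewrite big_nat [RHS]big_nat; apply: eq_bigr => n /andP[_]; rewrite ltnS leq_min => /andP[-> _] //.
  move=> n /andP[]; rewrite gtn_min => h1 h2; case: ifP => // nK.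
  by move: h1; rewrite ltnNge nK /= ltnNge -ltnS h2.
set D := (N %/ K)%N; have D0 : (0 < D)%N by rewrite divn_gt0.
have DN : (D <= N)%N by exact: leq_div.
rewrite {}E (big_cat_nat _ (n := D.+1)) //=.
have -> : \sum_(1 <= m < D.+1) Lam m * (minn K (N %/ m))%:R = K%:R * psi D.
  rewrite /chebyshev_psi mulr_sumr; apply: eq_big_nat => m /andP[m0 mD]; rewrite mulrC; congr (_%:R * _).
  apply/minn_idPl; rewrite leq_divRL // mulnC -leq_divRL //.
have /andP[a1 a2] := mertens R N0; have /andP[b1 b2] := mertens R D0.
move: a1 a2; rewrite (big_cat_nat _ (n := D.+1)) //=.
set X := \sum_(D.+1 <= _ < _) _; set Y := \sum_(1 <= _ < D.+1) _ / _ in b1 b2 *.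
set Z := \sum_(D.+1 <= _ < _) _ => a1 a2.
have np : (0 : R) < N%:R by rewrite ltr0n.
have kp : (0 : R) < K%:R by rewrite ltr0n.
have Dp : (1 : R) <= D%:R by rewrite ler1n.
have Z1 : Z <= N%:R * X.
  rewrite /Z /X mulr_sumr big_nat [X in _ <= X]big_nat; apply: ler_sum => m /andP[Dm _].
  rewrite mulrCA ler_wpM2l ?vonMangoldt_ge0 //.
  have /andP[h _] := @floor_bounds R N m (leq_ltn_trans (leq0n D) Dm).
  by apply: le_trans h; rewrite ler_nat geq_minr.
have Z2 : N%:R * X - psi N <= Z.
  rewrite lerBlDr (psi_cat R DN) addrCA.
  apply: (@le_trans _ _ (Z + \sum_(D.+1 <= k < N.+1) Lam k)); last by rewrite lerDr psi_ge0.
  rewrite /Z /X mulr_sumr -big_split /= big_nat [X in _ <= X]big_nat; apply: ler_sum => m /andP[Dm _].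
  rewrite mulrCA -[X in _ <= _ + X]mulr1 -mulrDr ler_wpM2l ?vonMangoldt_ge0 //.
  have /andP[_ h] := @floor_bounds R N m (leq_ltn_trans (leq0n D) Dm).
  apply: le_trans (ltW h) _; rewrite lerD2r ler_nat leq_min leqnn andbT.
  by apply: ltnW; rewrite ltn_divLR ?(leq_ltn_trans (leq0n D) Dm) // mulnC -ltn_divLR.
have pN := psi_le R N; have pD := psi_le R D; have pD0 := psi_ge0 R D.
have /andP[f1 f2] := @floor_bounds R N K K0; rewrite -/D in f1 f2.
have lD : ln (N%:R : R) - ln K%:R - 1 <= ln (D%:R : R) <= ln (N%:R : R) - ln (K%:R : R).
  rewrite -ln_div ?posrE //.
  have qp : (0 : R) < N%:R / K%:R by exact: divr_gt0.
  have Dpp : (0 : R) < D%:R by lra.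
  apply/andP; split; last by rewrite ler_ln ?posrE.
  rewrite lerBlDr -lerBlDl -ln_div ?posrE //.
  apply: le_trans (ln_le_sub1 (divr_gt0 qp Dpp)) _.
  by rewrite lerBlDr ler_pdivrMr //; lra.
have KD : K%:R * psi D <= 10 * N%:R.
  apply: (@le_trans _ _ (K%:R * (10 * D%:R))); first by rewrite ler_pM2l.
  by move: f1; rewrite ler_pdivlMr //; lra.
have KD0 : 0 <= K%:R * psi D by rewrite mulr_ge0.
have X1 : N%:R * X <= N%:R * (ln K%:R + 12) by rewrite ler_pM2l //; lra.
have X2 : N%:R * (ln K%:R - 11) <= N%:R * X by rewrite ler_pM2l //; lra.
apply/andP; split; lra.
Qed.

(** Selberg's function, supported on integers with at most two distinct prime factors. *)
Definition vonMangoldt2 k : R :=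
  Lam k * ln k%:R + \sum_(1 <= d < k.+1 | (d %| k)%N) Lam d * Lam (k %/ d).

Lemma vonMangoldt2_ge0 k : 0 <= vonMangoldt2 k.
Proof.
apply: addr_ge0; first by rewrite mulr_ge0 ?vonMangoldt_ge0 ?ln_nat_ge0.
by apply: sumr_ge0 => d _; rewrite mulr_ge0 ?vonMangoldt_ge0.
Qed.

(** Replacing [psi N * ln N] in [selberg_sum] by the sum of [Lam n * ln n] costs at most [10 * N],
    by [sum_vonMangoldt_ln_le]. *)
Lemma sum_vonMangoldt2 N : (0 < N)%N ->
  2 * N%:R * ln N%:R - 51 * N%:R <= \sum_(1 <= k < N.+1) vonMangoldt2 k
    <= 2 * N%:R * ln N%:R + 41 * N%:R.
Proof.
move=> N0.
have -> : \sum_(1 <= k < N.+1) vonMangoldt2 k =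
   selberg_sum N - \sum_(1 <= n < N.+1) Lam n * (ln N%:R - ln n%:R).
  rewrite /vonMangoldt2 big_split /=.
  have -> : \sum_(1 <= k < N.+1) \sum_(1 <= d < k.+1 | (d %| k)%N) Lam d * Lam (k %/ d) =
     \sum_(1 <= n < N.+1) Lam n * psi (N %/ n).
    rewrite (eq_big_nat _ _ (F2 := fun k => \sum_(1 <= d < N.+1 | (d %| k)%N) Lam d * Lam (k %/ d))); last first.
      by move=> k k_range; rewrite [RHS]sum_divisors.
    rewrite -(hyperbola (fun d k => Lam d * Lam (k %/ d))).
    apply: eq_big_nat => n /andP[n0 _]; rewrite /chebyshev_psi mulr_sumr.
    by apply: eq_bigr => m _; rewrite mulKn.
  under [in RHS]eq_bigr => n _ do rewrite mulrBr.
  rewrite sumrB -mulr_suml -/(chebyshev_psi R N) /selberg_sum; ring.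
have /andP[a b] := selberg N0; have /andP[c d] := sum_vonMangoldt_ln_le R N.
move: a b c d; set s := selberg_sum N; set t := \sum_(_ <= _ < _) _ => *.
apply/andP; split; lra.
Qed.

End Selberg.

(** * Bookkeeping of error terms *)

Lemma ler_normM_le (R : realDomainType) (p q B : R) :
  0 <= p -> p <= B -> `|q| <= 1 -> `|p * q| <= B.
Proof.
by move=> p0 pB q1; rewrite normrM (ger0_norm p0); apply: le_trans pB; rewrite ler_piMr.
Qed.

Lemma ler_norm_floor_diff (R : realDomainType) (x y u v : R) :
  u <= x < u + 1 -> v <= y < v + 1 -> `|v - u - (y - x)| <= 1.
Proof. by move=> /andP[? ?] /andP[? ?]; rewrite ler_norml; apply/andP; split; lra. Qed.

(** The errors in [gap_relation], with [x = N / n]; they add up to [161 * x], rounded up. *)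
Lemma gap_error_terms_le (R : realFieldType) (x u v r s e1 e2 e3 e4 e5 : R) :
  u <= x -> v <= 2 * x -> `|s| <= 41 * u -> `|r| <= 41 * v -> `|e1| <= 20 * x ->
  `|e2| <= 10 * x -> `|e3| <= 2 * x -> `|e4| <= x -> `|e5| <= x ->
  `|r - s - e1 + e2 + 2 * e3 - 2 * e4 + 2 * e5| <= 200 * x.
Proof.
rewrite !ler_norml => ? ? /andP[? ?] /andP[? ?] /andP[? ?] /andP[? ?] /andP[? ?] /andP[? ?] /andP[? ?].
by apply/andP; split; lra.
Qed.

Lemma selberg_norm (R : realType) n : (0 < n)%N ->
  `|selberg_sum R n - 2 * n%:R * ln n%:R| <= 41 * n%:R.
Proof.
by move=> /(selberg R) /andP[? ?]; rewrite ler_norml; apply/andP; split; lra.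
Qed.

Lemma ln_floor_bounds (R : realType) N d : (0 < d <= N)%N ->
  ln (N%:R : R) - ln d%:R - 1 <= ln (N %/ d)%:R <= ln (N%:R : R) - ln d%:R.
Proof.
move=> /andP[d0 dN]; have N0 := leq_trans d0 dN.
have /andP[f1 f2] := @floor_bounds R N d d0.
have Dp : (1 : R) <= (N %/ d)%:R by rewrite ler1n divn_gt0.
have Dpp : (0 : R) < (N %/ d)%:R by lra.
have qp : (0 : R) < N%:R / d%:R by rewrite divr_gt0 ?ltr0n.
rewrite -ln_div ?posrE ?ltr0n //; apply/andP; split; last by rewrite ler_ln ?posrE.
rewrite lerBlDr -lerBlDl -ln_div ?posrE //.
apply: le_trans (ln_le_sub1 (divr_gt0 qp Dpp)) _.
by rewrite lerBlDr ler_pdivrMr //; lra.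
Qed.

Lemma window_step_le (R : realDomainType) (n n' q : nat) : (n' <= n + n %/ q)%N ->
  q%:R * (n'%:R - n%:R) <= (n%:R : R).
Proof.
move=> nq; rewrite mulrBr lerBlDr -!natrM -natrD ler_nat.
apply: leq_trans (leq_mul (leqnn q) nq) _.
by rewrite mulnDr addnC leq_add2r mulnC leq_divM.
Qed.

Lemma window_mass_arith (R : realFieldType) (x x' q l z : R) :
  x * l <= 2 * (q * (x' - x)) * l -> q * (2 * (x' - x) * l - 143 * x) <= z ->
  286 * q * x <= l * x -> l * x' <= l * (2 * x) -> l * x' <= 4 * z.
Proof.
have -> : x * l = l * x by rewrite mulrC.
have -> : 2 * (q * (x' - x)) * l = 2 * (q * (x' - x) * l) by ring.
have -> : q * (2 * (x' - x) * l - 143 * x) = 2 * (q * (x' - x) * l) - 143 * (q * x) by ring.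
have -> : 286 * q * x = 286 * (q * x) by ring.
have -> : l * (2 * x) = 2 * (l * x) by ring.
by move: (q * (x' - x) * l) (q * x) (l * x) (l * x') => *; lra.
Qed.

(** * Consequences of a gap [(N, M]] without prime powers, expressed by [psi_eq] *)

Section PrimeGap.
Variables (R : realType) (N M : nat) (delta : R).
Hypotheses (delta_gt0 : 0 < delta) (delta_le1 : delta <= 1).
Hypotheses (N_gt0 : (0 < N)%N) (M_ge : (1 + delta) * N%:R <= M%:R) (M_le : (M <= 2 * N)%N).
Hypothesis psi_eq : chebyshev_psi R M = chebyshev_psi R N.
Implicit Types (n m k t : nat).

Local Notation Lam := (vonMangoldt R).
Local Notation psi := (@chebyshev_psi R).
Local Notation L n := (ln (N%:R : R) - ln n%:R).
Local Notation G := (M%:R - N%:R : R).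

(* The density of prime powers in (N/n, M/n], of average 1; the parity heuristic is
   that it is close to 2 at prime powers n and to 0 at products of two of them. *)
Definition gap_density n : R := n%:R * (psi (M %/ n) - psi (N %/ n)) / G.
Local Notation a := gap_density.

(** The 200 is that of [gap_error_terms_le]; [1 / delta] bounds [N / G] by [gap_ratio]. *)
Definition gap_error : R := 200 / delta.
Local Notation c1 := gap_error.

Lemma gap_N_gt0 : (0 : R) < N%:R. Proof. by rewrite ltr0n. Qed.

Lemma gap_length_ge : delta * N%:R <= G. Proof. by move: M_ge; lra. Qed.

Lemma gap_length_gt0 : 0 < G.
Proof. by apply: lt_le_trans gap_length_ge; rewrite mulr_gt0 // ltr0n. Qed.

Lemma gap_ratio : N%:R / G <= delta^-1.
Proof.
rewrite ler_pdivrMr ?gap_length_gt0 // ler_pdivlMl //; exact: gap_length_ge.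
Qed.

Lemma gap_N_le_M : (N <= M)%N.
Proof. by rewrite -(ler_nat R); have := gap_length_gt0; lra. Qed.

Lemma gap_M_le : (M%:R : R) <= 2 * N%:R.
Proof. by rewrite -natrM ler_nat. Qed.

Lemma gap_density_ge0 n : 0 <= a n.
Proof.
apply: divr_ge0; last exact: ltW gap_length_gt0.
by rewrite mulr_ge0 // subr_ge0 ler_psi // leq_div2r // gap_N_le_M.
Qed.

Lemma gap_density1 : a 1%N = 0.
Proof. by rewrite /gap_density !divn1 psi_eq subrr mulr0 mul0r. Qed.

Lemma gap_density_le n : a n <= 20 / delta.
Proof.
case: (posnP n) => [->|n1]; first by rewrite /gap_density !mul0r divr_ge0 // ltW.
have n0 : (0 : R) < n%:R by rewrite ltr0n.
have /andP[h _] := @floor_bounds R M n n1.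
have p1 := psi_le R (M %/ n); have p2 := psi_ge0 R (N %/ n).
have h2 : n%:R * (psi (M %/ n) - psi (N %/ n)) <= 20 * N%:R.
  apply: (@le_trans _ _ (n%:R * (10 * (M%:R / n%:R)))).
    by rewrite ler_pM2l //; move: h; set y := _ / _ => h; lra.
  have -> : n%:R * (10 * (M%:R / n%:R)) = 10 * M%:R :> R.
    by field; rewrite lt0r_neq0.
  by have := gap_M_le; lra.
apply: (@le_trans _ _ (20 * N%:R / G)).
  by rewrite ler_wpM2r // invr_ge0 ltW // gap_length_gt0.
by rewrite -mulrA ler_pM2l ?ltr0n // gap_ratio.
Qed.

(** The difference of Selberg's formula at [M %/ n] and [N %/ n], scaled by [n / G]. Both logarithms
    are within 1 of [L n], so all errors are [O(N / n)] before scaling and [O(N / G)] after it. *)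
Lemma gap_relation n : (0 < n <= N)%N ->
  `|a n * L n + \sum_(1 <= m < (N %/ n).+1) Lam m / m%:R * a (n * m)%N - 2 * L n| <= c1.
Proof.
move=> /andP[n0 nN].
have np : (0 : R) < n%:R by rewrite ltr0n.
set u := (N %/ n)%N; set v := (M %/ n)%N.
have u0 : (0 < u)%N by rewrite divn_gt0.
have uv : (u <= v)%N by exact: leq_div2r gap_N_le_M.
have v0 := leq_trans u0 uv.
have /andP[u1 u2] := @floor_bounds R N n n0; rewrite -/u in u1 u2.
have /andP[v1 v2] := @floor_bounds R M n n0; rewrite -/v in v1 v2.
set x : R := N%:R / n%:R in u1 u2.
have xp : 0 < x by rewrite divr_gt0 ?gap_N_gt0.
set y : R := M%:R / n%:R in v1 v2.
have yx : y <= 2 * x.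
  by rewrite /y /x mulrA ler_pM2r ?invr_gt0 // gap_M_le.
have ur : (1 : R) <= u%:R by rewrite ler1n.
have uvr : (u%:R : R) <= v%:R by rewrite ler_nat.
have LE : L n = ln x by rewrite /x ln_div ?posrE ?gap_N_gt0.
have lu := @ln_floor_bounds R N n; rewrite n0 nN -/u in lu; have {}lu := lu isT.
have lv : L n - 1 <= ln (v%:R : R) <= L n + 1.
  apply/andP; split.
    by move: lu => /andP[h _]; apply: le_trans h _; exact: ler_ln_nat.
  have vp : (0 : R) < v%:R by rewrite ltr0n.
  rewrite LE -lerBlDl -ln_div ?posrE //.
  apply: le_trans (ln_le_sub1 (divr_gt0 vp xp)) _.
  by rewrite lerBlDr ler_pdivrMr //; apply: le_trans v1 _; apply: le_trans yx _; rewrite lexx.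
have L0 : 0 <= L n by move: lu => /andP[_]; apply: le_trans; exact: ln_nat_ge0.
have Lx : L n <= x by rewrite LE ltW // ln_sublinear.
have pu := psi_le R u; have pv := psi_le R v.
have pu0 := psi_ge0 R u; have pv0 := psi_ge0 R v.
set S := \sum_(1 <= m < u.+1) Lam m * (psi (M %/ (n * m)) - psi (N %/ (n * m))).
have SE : selberg_sum R v - selberg_sum R u = psi v * ln v%:R - psi u * ln u%:R + S.
  rewrite /selberg_sum (big_cat_nat _ (n := u.+1)) //=.
  rewrite [X in _ + (_ + X)]big_nat [X in _ + (_ + X)]big1.
    rewrite /S; under [in RHS]eq_bigr => m _ do rewrite mulrBr.
    rewrite sumrB /u /v; under [in LHS]eq_bigr => m _ do rewrite -divnMA.
    under [X in _ - (_ + X)]eq_bigr => m _ do rewrite -divnMA.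
    ring.
  (* For [m > u] one has [n * m > N], so [M <= 2 * N] forces [M %/ (n * m) < 2], where [psi]
     vanishes. *)
  move=> m /andP[um _]; rewrite -divnMA.
  have : (M %/ (n * m) < 2)%N.
    rewrite ltn_divLR ?muln_gt0 ?n0 ?(leq_ltn_trans _ um) //.
    apply: leq_ltn_trans M_le _; rewrite ltn_mul2l /= mulnC -ltn_divLR //.
  by case: (_ %/ _)%N => [|[]] // _; rewrite ?psi0 ?psi1 mulr0.
have {}lu : `|ln u%:R - L n| <= 1.
  by rewrite ler_distl; move: lu => /andP[-> h] /=; rewrite (le_trans h) // lerDl.
have {}lv : `|ln v%:R - L n| <= 1.
  by rewrite ler_distl.
have [v2x u1x] : v%:R <= 2 * x /\ u%:R <= x by split; [exact: le_trans yx | exact: u1].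
have {}pv : psi v <= 20 * x.
  by apply: le_trans pv _; rewrite (_ : 20 = 10 * 2) -?mulrA ?ler_pM2l //; ring.
have {}pu : psi u <= 10 * x by apply: le_trans pu _; rewrite ler_pM2l.
have e1 := ler_normM_le pv0 pv lv.
have e2 := ler_normM_le pu0 pu lu.
have e3 := ler_normM_le (ler0n R v) v2x lv.
have e4 := ler_normM_le (ler0n R u) u1x lu.
have e5 : `|L n * (v%:R - u%:R - (y - x))| <= x.
  by apply: ler_normM_le => //; apply: ler_norm_floor_diff; apply/andP.
have main : `|(psi v - psi u) * L n + S - 2 * (y - x) * L n| <= 200 * x.
  set e1x := psi v * _ in e1; set e2x := psi u * _ in e2; set e3x := v%:R * _ in e3.
  set e4x := u%:R * _ in e4; set e5x := L n * _ in e5.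
  have -> : (psi v - psi u) * L n + S - 2 * (y - x) * L n =
     (selberg_sum R v - 2 * v%:R * ln v%:R) - (selberg_sum R u - 2 * u%:R * ln u%:R)
     - e1x + e2x + 2 * e3x - 2 * e4x + 2 * e5x.
    have -> : S = selberg_sum R v - selberg_sum R u - psi v * ln v%:R + psi u * ln u%:R.
      by rewrite SE; ring.
    by rewrite /e1x /e2x /e3x /e4x /e5x; ring.
  by apply: (gap_error_terms_le u1x v2x) => //; exact: selberg_norm.
have SG : \sum_(1 <= m < u.+1) Lam m / m%:R * a (n * m)%N = n%:R / G * S.
  rewrite /S mulr_sumr big_nat [RHS]big_nat; apply: eq_bigr => m /andP[m0 _].
  have mp : m%:R != 0 :> R by rewrite pnatr_eq0 -lt0n.
  have Gp : G != 0 by rewrite lt0r_neq0 // gap_length_gt0.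
  rewrite /gap_density natrM; field; by rewrite mp Gp.
have yG : y - x = G / n%:R by rewrite /x /y mulrBl.
have Gp := gap_length_gt0.
rewrite SG /gap_density -/u -/v.
have -> : n%:R * (psi v - psi u) / G * L n + n%:R / G * S - 2 * L n =
   n%:R / G * ((psi v - psi u) * L n + S - 2 * (y - x) * L n).
  rewrite yG; field; by rewrite !lt0r_neq0.
have nG0 : 0 <= n%:R / G by apply: divr_ge0 => //; exact: ltW.
rewrite normrM (ger0_norm nG0).
apply: (@le_trans _ _ (n%:R / G * (200 * x))); first by rewrite ler_wpM2l.
have -> : n%:R / G * (200 * x) = 200 * (N%:R / G).
  rewrite /x; field; by rewrite !lt0r_neq0.
by rewrite ler_pM2l ?ltr0n // gap_ratio.
Qed.

Lemma gap_error_ge : 200 <= c1.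
Proof. by rewrite /gap_error ler_pdivlMr //; have := delta_le1; lra. Qed.

(** At [n = 1] the density is 0, so [gap_relation] gives the sum of [Lam n / n * a n] as
    [2 * ln N + O(1)]; Mertens' theorem gives the same for the weight 2. *)
Lemma gap_sum_prime_le : \sum_(1 <= n < N.+1) Lam n / n%:R * (2 - a n) <= c1 + 20.
Proof.
have := @gap_relation 1%N; rewrite N_gt0 => /(_ isT); rewrite gap_density1 mul0r add0r divn1 ln1 subr0.
under eq_bigr => m _ do rewrite mul1n.
rewrite ler_norml => /andP[h _].
under eq_bigr => m _ do rewrite mulrBr.
rewrite sumrB -mulr_suml; have /andP[_] := mertens R N_gt0.
move: h; set s := \sum_(_ <= _ < _) _ * a _; set r := \sum_(_ <= _ < _) _; lra.
Qed.

(** For [b = 2 - a] this measures the deviation from the parity heuristic: [a] should be 2 on prime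
    powers and 0 on products of two. The weight [b] is left free so that a slack can be added. *)
Definition gap_form (b : nat -> R) : R := \sum_(1 <= k < N.+1)
  (Lam k * ln k%:R * b k + (\sum_(1 <= d < k.+1 | (d %| k)%N) Lam d * Lam (k %/ d)) * a k) / k%:R.

(** With the convolution grouped by its factor [n], [gap_relation] bounds the inner sum by
    [(2 - a n) * L n + c1]. Adding [(2 - a n) * ln n] completes [L n] to [ln N], and
    [gap_sum_prime_le] leaves only [O(ln N)] instead of [(ln N)^2]. *)
Lemma gap_form_le : gap_form (fun k => 2 - a k) <= 20 * c1 * (1 + ln N%:R).
Proof.
rewrite /gap_form.
have -> : \sum_(1 <= k < N.+1) (Lam k * ln k%:R * (2 - a k) +
   (\sum_(1 <= d < k.+1 | (d %| k)%N) Lam d * Lam (k %/ d)) * a k) / k%:R =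
   \sum_(1 <= n < N.+1) Lam n / n%:R * (ln n%:R * (2 - a n) +
     \sum_(1 <= m < (N %/ n).+1) Lam m / m%:R * a (n * m)%N).
  under eq_bigr => k _ do rewrite mulrDl.
  rewrite big_split /=; under [RHS]eq_bigr => k _ do rewrite mulrDr.
  rewrite [RHS]big_split /=; congr (_ + _); first by apply: eq_bigr => k _; ring.
  transitivity (\sum_(1 <= k < N.+1) \sum_(1 <= d < N.+1 | (d %| k)%N)
      Lam d * Lam (k %/ d) * a k / k%:R).
    apply: eq_big_nat => k k_range; rewrite [RHS]sum_divisors //.
    by rewrite !mulr_suml.
  rewrite -(hyperbola (fun d k => Lam d * Lam (k %/ d) * a k / k%:R)).
  apply: eq_big_nat => n /andP[n0 _]; rewrite mulr_sumr; apply: eq_bigr => m _.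
  rewrite mulKn // natrM invfM; ring.
apply: (@le_trans _ _ (\sum_(1 <= n < N.+1) Lam n / n%:R * (ln N%:R * (2 - a n) + c1))).
  rewrite big_nat [X in _ <= X]big_nat; apply: ler_sum => n n_range.
  rewrite ler_wpM2l ?divr_ge0 ?vonMangoldt_ge0 //.
  have := gap_relation n_range; rewrite ler_norml => /andP[_].
  set s := \sum_(_ <= _ < _) _; lra.
have -> : \sum_(1 <= n < N.+1) Lam n / n%:R * (ln N%:R * (2 - a n) + c1) =
   ln N%:R * (\sum_(1 <= n < N.+1) Lam n / n%:R * (2 - a n)) + c1 * \sum_(1 <= n < N.+1) Lam n / n%:R.
  rewrite !mulr_sumr -big_split /=; apply: eq_bigr => n _; ring.
have h1 := gap_sum_prime_le; have /andP[_ h2] := mertens R N_gt0; have c := gap_error_ge.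
have c0 : 0 <= c1 by lra.
have l0 := @ln_nat_ge0 R N.
have : ln N%:R * (\sum_(1 <= n < N.+1) Lam n / n%:R * (2 - a n)) <= ln N%:R * (c1 + 20).
  by rewrite ler_wpM2l.
have : c1 * (\sum_(1 <= n < N.+1) Lam n / n%:R) <= c1 * (ln N%:R + 10) by rewrite ler_wpM2l.
have : 200 * ln N%:R <= c1 * ln N%:R by rewrite ler_wpM2r.
have : 0 <= c1 * ln N%:R by rewrite mulr_ge0.
set A := \sum_(_ <= _ < _) _ * (2 - _); set B := \sum_(_ <= _ < _) _.
by move: (c1) (ln N%:R) A B c0 l0 c => c l A B *; lra.
Qed.

(* A bound for the negative part of 2 - a k, small unless k is within a factor t of N. *)
Definition gap_slack t k : R := if (k <= N %/ t)%N then c1 / ln t%:R else 20 / delta.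

Lemma gap_slack_ge0 t k : 0 <= gap_slack t k.
Proof.
rewrite /gap_slack; case: ifP => _; rewrite divr_ge0 ?ln_nat_ge0 ?ltW //.
by rewrite /gap_error divr_gt0 ?ltr0n.
Qed.

(** The sum in [gap_relation] is nonnegative, so [(a k - 2) * L k <= c1], and [L k >= ln t] for
    [k <= N %/ t]. For larger [k], [gap_density_le] suffices. *)
Lemma gap_slackP t k : (1 < t)%N -> (0 < k <= N)%N -> 0 <= 2 - a k + gap_slack t k.
Proof.
move=> t1 /andP[k0 kN]; rewrite /gap_slack; case: ifP => [kt|_]; last first.
  by have := gap_density_le k; set z := 20 / delta; lra.
have := @gap_relation k; rewrite k0 kN => /(_ isT); rewrite ler_norml => /andP[_].
have : 0 <= \sum_(1 <= m < (N %/ k).+1) Lam m / m%:R * a (k * m)%N.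
  apply: sumr_ge0 => m _; by rewrite mulr_ge0 ?gap_density_ge0 ?divr_ge0 ?vonMangoldt_ge0.
have tp : 0 < ln (t%:R : R) by rewrite ln_gt0 // ltr1n.
have tl : ln t%:R <= L k.
  rewrite lerBrDl -lnM ?posrE ?ltr0n // ?(ltnW t1) // -natrM ler_ln_nat //.
  by rewrite -leq_divRL // ltnW.
have := gap_error_ge.
set s := \sum_(_ <= _ < _) _; set l := L k in tl * => c s0 h.
have [b0|b0] := leP 0 (2 - a k); first by rewrite addr_ge0 // divr_ge0 ?ltW //; lra.
rewrite -lerBlDl sub0r ler_pdivlMr // mulNr lerNl.
by nra.
Qed.

(** The slack is small up to [N %/ t], and beyond it the Mertens sum is at most [ln t + 12]: the
    first range costs a small multiple of [(ln N)^2], the second [O(ln N)]. *)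
Lemma gap_form_slack_le t : (1 < t <= N)%N ->
  gap_form (fun k => 2 - a k + gap_slack t k) <= 20 * c1 * (1 + ln N%:R)
    + ln N%:R * (c1 / ln t%:R * (ln N%:R + 10) + 20 / delta * (ln t%:R + 12)).
Proof.
move=> /andP[t1 tN]; have t0 : (0 < t)%N := ltnW t1.
have -> : gap_form (fun k => 2 - a k + gap_slack t k) = gap_form (fun k => 2 - a k) +
    \sum_(1 <= k < N.+1) Lam k / k%:R * ln k%:R * gap_slack t k.
  rewrite /gap_form -big_split /=; apply: eq_bigr => k _; ring.
apply: lerD; first exact: gap_form_le.
set D := (N %/ t)%N; have D0 : (0 < D)%N by rewrite divn_gt0.
have DN : (D <= N)%N by exact: leq_div.
apply: (@le_trans _ _ (\sum_(1 <= k < N.+1) ln N%:R * (Lam k / k%:R * gap_slack t k))).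
  rewrite big_nat [X in _ <= X]big_nat; apply: ler_sum => k /andP[k0 kN].
  rewrite mulrAC [X in _ <= X]mulrC ler_wpM2l ?ler_ln_nat //.
  by rewrite mulr_ge0 ?gap_slack_ge0 ?divr_ge0 ?vonMangoldt_ge0.
rewrite -mulr_sumr ler_wpM2l ?ln_nat_ge0 // (big_cat_nat _ (n := D.+1)) //=.
have tp : 0 < ln (t%:R : R) by rewrite ln_gt0 // ltr1n.
have cp := gap_error_ge.
have /andP[a1 a2] := mertens R N_gt0; have /andP[b1 b2] := mertens R D0.
have tr : (0 : R) < t%:R by rewrite ltr0n.
have := @ln_floor_bounds R N t; rewrite t0 tN -/D => /(_ isT) /andP[lD _].
have lDN : ln (D%:R : R) <= ln N%:R by exact: ler_ln_nat.
apply: lerD.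
  rewrite big_nat (eq_bigr (fun k => Lam k / k%:R * (c1 / ln t%:R))).
    rewrite -big_nat -mulr_suml mulrC ler_wpM2l //; last by apply: le_trans b2 _; rewrite lerD2r.
    by apply: divr_ge0 (ltW tp); lra.
  by move=> k /andP[_ kD]; rewrite /gap_slack -ltnS kD.
rewrite big_nat (eq_bigr (fun k => Lam k / k%:R * (20 / delta))).
  rewrite -big_nat -mulr_suml mulrC ler_wpM2l ?divr_ge0 ?(ltW delta_gt0) //.
  move: a2; rewrite (big_cat_nat _ (n := D.+1)) //=.
  by move: b1; set x := \sum_(_ <= _ < _) _; set y := \sum_(_ <= _ < _) _; lra.
by move=> k /andP[Dk _]; rewrite /gap_slack leqNgt Dk.
Qed.

Definition gap_term t k : R :=
  (Lam k * ln k%:R * (2 - a k + gap_slack t k) +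
   (\sum_(1 <= d < k.+1 | (d %| k)%N) Lam d * Lam (k %/ d)) * a k) / k%:R.

(** With both weights at least [c], only the total [vonMangoldt2 k] matters, not its division
    between primes and products of two primes, which Selberg's formula cannot see. *)
Lemma gap_term_ge t k (c : R) : (1 < t)%N -> (0 < k <= N)%N ->
  0 <= c <= a k -> c <= 2 - a k + gap_slack t k -> c * vonMangoldt2 R k / k%:R <= gap_term t k.
Proof.
move=> t1 k_range /andP[c0 ca] cb; rewrite /gap_term /vonMangoldt2 ler_wpM2r ?invr_ge0 //.
rewrite mulrDr lerD //.
  by rewrite mulrC ler_wpM2l // mulr_ge0 ?vonMangoldt_ge0 ?ln_nat_ge0.
rewrite mulrC ler_wpM2l //; apply: sumr_ge0 => d _.
by rewrite mulr_ge0 ?vonMangoldt_ge0.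
Qed.

Lemma gap_term_ge0 t k : (1 < t)%N -> (0 < k <= N)%N -> 0 <= gap_term t k.
Proof.
move=> t1 k_range; have := @gap_term_ge t k 0 t1 k_range; rewrite !mul0r; apply.
  by rewrite lexx gap_density_ge0.
exact: gap_slackP.
Qed.

(** [psi_short_le] on [(X %/ n', X %/ n]]. The length gives [4 / q]; rounding and the error term
    give [338 = 2 + 84 * 4] over [ln s]. *)
Lemma gap_psi_diff (X n n' q s : nat) : (N <= X <= 2 * N)%N ->
  (0 < n <= n')%N -> (n' <= n + n %/ q)%N -> (n' <= N %/ s)%N -> (0 < q)%N -> (1 < s)%N ->
  0 <= n'%:R * (psi (X %/ n) - psi (X %/ n')) <= N%:R * (4 / q%:R + 338 / ln s%:R).
Proof.
move=> /andP[NX X2] /andP[n0 nn] nq ns q0 s1.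
have n'0 := leq_trans n0 nn; have s0 := ltnW s1.
have n'N : (n' <= N)%N by apply: leq_trans ns _; exact: leq_div.
have UV : (X %/ n' <= X %/ n)%N by exact: leq_div2l.
apply/andP; split; first by rewrite mulr_ge0 // subr_ge0 ler_psi.
have U0 : (0 < X %/ n')%N by rewrite divn_gt0 // (leq_trans n'N).
have ls : 0 < ln (s%:R : R) by rewrite ln_gt0 // ltr1n.
have sV : (s <= X %/ n)%N.
  rewrite leq_divRL // (leq_trans _ NX) // mulnC -leq_divRL //; exact: leq_trans ns.
have lsV : ln (s%:R : R) <= ln (X %/ n)%:R by exact: ler_ln_nat.
have := @psi_short_le R (X %/ n') (X %/ n); rewrite U0 UV => /(_ isT).
have /andP[V1 _] := @floor_bounds R X n n0.
have /andP[_ U1] := @floor_bounds R X n' n'0.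
have np : (0 : R) < n%:R by rewrite ltr0n.
have n'p : (0 : R) < n'%:R by rewrite ltr0n.
have qp : (0 : R) < q%:R by rewrite ltr0n.
have Xr : (X%:R : R) <= 2 * N%:R by rewrite -natrM ler_nat.
have n'q := @window_step_le R _ _ _ nq.
have n'2 : (n'%:R : R) <= 2 * n%:R.
  by rewrite -natrM ler_nat; apply: leq_trans nq _; rewrite mul2n -addnn leq_add2l leq_div.
have n's : n'%:R * ln (s%:R : R) <= N%:R.
  apply: (@le_trans _ _ (n'%:R * s%:R)); first by rewrite ler_wpM2l // ln_nat_le.
  by rewrite -natrM ler_nat -leq_divRL.
move: V1 U1 lsV; set V : R := (X %/ n)%:R; set U : R := (X %/ n')%:R; set l := ln s%:R.
set P := psi _ - psi _ => V1 U1 lsV hP.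
have lV : 0 < ln V by exact: lt_le_trans lsV.
have V0 : 0 <= V by rewrite ler0n.
have P1 : P <= 2 * (V - U) + 84 * V / l.
  apply: (@le_trans _ _ (2 * (V - U) + 84 * V / ln V)).
    by rewrite -(ler_pM2r lV) [X in _ <= X]mulrDl divfK ?(lt0r_neq0 lV).
  by rewrite lerD2l ler_wpM2l ?mulr_ge0 // lef_pV2 ?posrE.
have e1 : n'%:R * (X%:R / n%:R - X%:R / n'%:R) <= (2 * N%:R / q%:R : R).
  have -> : n'%:R * (X%:R / n%:R - X%:R / n'%:R) = X%:R * ((n'%:R - n%:R) / n%:R) :> R.
    by field; rewrite !lt0r_neq0.
  apply: (@le_trans _ _ (X%:R * q%:R^-1)); last by rewrite ler_wpM2r // invr_ge0 ltW.
  by rewrite ler_wpM2l // ler_pdivrMr // mulrC ler_pdivlMr // mulrC.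
have e2 : n'%:R <= N%:R / l by rewrite ler_pdivlMr.
have e3 : n'%:R * V <= 4 * N%:R.
  apply: (@le_trans _ _ (2 * n%:R * V)); first by rewrite ler_wpM2r.
  rewrite -mulrA (_ : 4 = 2 * 2) -?[2 * 2 * _]mulrA ?ler_pM2l //; last by ring.
  by apply: le_trans Xr; rewrite mulrC -ler_pdivlMr.
have e4 : n'%:R * V / l <= 4 * N%:R / l by rewrite ler_wpM2r // invr_ge0 ltW.
have VU : n'%:R * (V - U) <= n'%:R * (X%:R / n%:R - X%:R / n'%:R) + n'%:R.
  by rewrite -[X in _ <= _ + X]mulr1 -mulrDr ler_wpM2l // (le_trans (lerB V1 (ltW (_ : X%:R / n'%:R - 1 < U)))) ?ltrBlDr // opprB addrA addrAC.
apply: (@le_trans _ _ (n'%:R * (2 * (V - U) + 84 * V / l))); first by rewrite ler_wpM2l.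
have -> : n'%:R * (2 * (V - U) + 84 * V / l) = 2 * (n'%:R * (V - U)) + 84 * (n'%:R * V / l).
  by rewrite mulrDr; congr (_ + _); [rewrite mulrCA | rewrite !mulrA [n'%:R * 84]mulrC].
have -> : N%:R * (4 / q%:R + 338 / l) = 2 * (2 * N%:R / q%:R) + 2 * (N%:R / l) + 84 * (4 * N%:R / l).
  by field; rewrite !lt0r_neq0.
move: VU e1 e2 e4.
set w1 := _ * (V - U); set w2 := _ * (_ - _); set w3 := _ / q%:R; set w4 := N%:R / l.
set w5 := _ / l; set w6 := _ / l => *; lra.
Qed.

(** * Multiplicative windows in which the density is balanced *)

Section Windows.
Variables (q s t : nat).
Hypotheses (q_ge : 200 / delta <= q%:R) (s_ge : 2720 / delta <= ln (s%:R : R)) (t_gt1 : (1 < t)%N).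

Lemma window_q_gt0 : (0 < q)%N.
Proof.
by rewrite -(ltr0n R); apply: lt_le_trans q_ge; rewrite divr_gt0 ?ltr0n.
Qed.

Lemma window_s_gt1 : (1 < s)%N.
Proof.
rewrite ltnNge; apply/negP => s1.
have ls : ln (s%:R : R) <= 0 by apply: ln_le0; rewrite lern1.
by have := le_trans s_ge ls; rewrite leNgt divr_gt0 ?ltr0n.
Qed.

(** The change splits into that of the factor [n], at most [1 / 10] by the choice of [q], and those
    of [psi] near [M / n] and near [N / n], each at most [0.145] and of opposite signs. *)
Lemma gap_density_near n n' : (0 < n <= n')%N -> (n' <= n + n %/ q)%N -> (n' <= N %/ s)%N ->
  `|a n' - a n| <= 4^-1.
Proof.
move=> nn nq ns; have q0 := window_q_gt0; have s1 := window_s_gt1.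
have /andP[A0 A1] := @gap_psi_diff M n n' q s (introT andP (conj gap_N_le_M M_le)) nn nq ns q0 s1.
have NN : (N <= N <= 2 * N)%N by rewrite leqnn mul2n -addnn leq_addr.
have /andP[B0 B1] := @gap_psi_diff N n n' q s NN nn nq ns q0 s1.
move: nn => /andP[n0 nn].
have Gp := gap_length_gt0; have Gd := gap_length_ge.
have np : (0 : R) < n%:R by rewrite ltr0n.
have qp : (0 : R) < q%:R by rewrite ltr0n.
have sp : 0 < ln (s%:R : R) by rewrite ln_gt0 // ltr1n.
(* This is where the size of [s] enters: [4 / 200 + 338 / 2720 < 0.145]. *)
have E : N%:R * (4 / q%:R + 338 / ln s%:R) <= (145 / 1000) * G.
  apply: (@le_trans _ _ (145 / 1000 * (delta * N%:R))); last by rewrite ler_pM2l ?divr_gt0 ?ltr0n.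
  have i1 : q%:R^-1 <= delta / 200 by rewrite -[X in _ <= X]invf_div lef_pV2 ?posrE ?divr_gt0 ?ltr0n.
  have i2 : (ln s%:R)^-1 <= delta / 2720.
    by rewrite -[X in _ <= X]invf_div lef_pV2 ?posrE ?divr_gt0 ?ltr0n.
  rewrite mulrA mulrC ler_wpM2r //.
  move: i1 i2; move: (q%:R^-1) (ln s%:R)^-1 delta_gt0 => x y *; lra.
have P : 0 <= (n'%:R - n%:R) / n%:R * a n <= 10^-1.
  have nn0 : (0 : R) <= n'%:R - n%:R by rewrite subr_ge0 ler_nat.
  have n'q : (n'%:R - n%:R) / n%:R <= (q%:R^-1 : R).
    by rewrite ler_pdivrMr // ler_pdivlMl //; exact: window_step_le.
  rewrite mulr_ge0 ?gap_density_ge0 ?divr_ge0 //=.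
  apply: (@le_trans _ _ (q%:R^-1 * (20 / delta))).
    apply: ler_pM => //; [exact: divr_ge0 | exact: gap_density_ge0 | exact: gap_density_le].
  rewrite ler_pdivrMl //.
  have -> : 20 / delta = 200 / delta * 10^-1 by field; rewrite lt0r_neq0.
  by rewrite ler_pM2r ?invr_gt0.
have -> : a n' - a n = (n'%:R - n%:R) / n%:R * a n
   - n'%:R * (psi (M %/ n) - psi (M %/ n')) / G + n'%:R * (psi (N %/ n) - psi (N %/ n')) / G.
  by rewrite /gap_density; field; rewrite !lt0r_neq0.
have {}A0 : 0 <= n'%:R * (psi (M %/ n) - psi (M %/ n')) / G by rewrite divr_ge0 // ltW.
have {}B0 : 0 <= n'%:R * (psi (N %/ n) - psi (N %/ n')) / G by rewrite divr_ge0 // ltW.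
have {}A1 : n'%:R * (psi (M %/ n) - psi (M %/ n')) / G <= 145 / 1000.
  by rewrite ler_pdivrMr //; apply: le_trans A1 E.
have {}B1 : n'%:R * (psi (N %/ n) - psi (N %/ n')) / G <= 145 / 1000.
  by rewrite ler_pdivrMr //; apply: le_trans B1 E.
move: P A0 B0 A1 B1 => /andP[].
set w1 := _ * a n; set w2 := _ / G; set w3 := _ / G => *.
rewrite ler_norml; apply/andP; split; lra.
Qed.

(** [sum_psi_floor_range] at [V] and [W], for [M] and for [N]: the errors [44 * M + 44 * N] are at
    most [132 * N]. *)
Lemma gap_density_sum V W : (0 < V <= W)%N -> (W <= N)%N ->
  `|\sum_(V.+1 <= n < W.+1) a n / n%:R - (ln W%:R - ln V%:R)| <= 132 / delta.
Proof.
move=> /andP[V0 VW] WN; have W0 := leq_trans V0 VW; have Gp := gap_length_gt0.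
have E : \sum_(V.+1 <= n < W.+1) a n / n%:R =
    (\sum_(V.+1 <= n < W.+1) psi (M %/ n) - \sum_(V.+1 <= n < W.+1) psi (N %/ n)) / G.
  rewrite -sumrB mulr_suml big_nat [RHS]big_nat; apply: eq_bigr => n /andP[Vn _].
  have n0 : (n%:R : R) != 0 by rewrite pnatr_eq0 -lt0n (leq_ltn_trans _ Vn).
  by rewrite /gap_density; field; rewrite n0 lt0r_neq0.
have h X : (N <= X)%N -> `|\sum_(V.+1 <= n < W.+1) psi (X %/ n)
     - X%:R * (ln W%:R - ln V%:R)| <= 44 * X%:R.
  move=> NX.
  have := @sum_psi_floor_range R X V; rewrite V0 (leq_trans VW (leq_trans WN NX)) => /(_ isT) /andP[v1 v2].
  have := @sum_psi_floor_range R X W; rewrite W0 (leq_trans WN NX) => /(_ isT) /andP[].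
  rewrite (big_cat_nat _ (n := V.+1)) //=; move: v1 v2.
  set A := \sum_(1 <= _ < V.+1) _; set B := \sum_(V.+1 <= _ < _) _ => *.
  by rewrite ler_norml; apply/andP; split; lra.
have := h M gap_N_le_M; have := h N (leqnn N); rewrite E.
set A := \sum_(_ <= _ < _) _; set B := \sum_(_ <= _ < _) _; set l := _ - ln _.
move=> hN hM; have -> : (B - A) / G - l = ((B - M%:R * l) - (A - N%:R * l)) / G.
  by field; rewrite lt0r_neq0.
rewrite normrM [`|G^-1|]ger0_norm ?invr_ge0 ?(ltW Gp) //.
apply: (@le_trans _ _ (132 * N%:R / G)).
  rewrite ler_wpM2r ?invr_ge0 ?(ltW Gp) // (le_trans (ler_normB _ _)) //.
  by have := gap_M_le; lra.
by rewrite -mulrA ler_pM2l ?ltr0n // gap_ratio.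
Qed.

(** A discrete intermediate value argument: with steps of at most [1 / 4], a density avoiding
    [[1/2, 3/2]] stays on one side of it, which contradicts the average 1 over a long window. *)
Lemma gap_balanced_exists V W : (q <= V <= W)%N -> (W <= N %/ s)%N ->
  267 / delta < ln W%:R - ln V%:R ->
  exists2 n, (V < n <= W)%N & 2^-1 <= a n <= 3 / 2.
Proof.
move=> /andP[qV VW] Ws lVW; have q0 := window_q_gt0; have V0 := leq_trans q0 qV.
have WN : (W <= N)%N by apply: leq_trans Ws (leq_div _ _).
have V1W : (V < W)%N.
  rewrite ltn_neqAle VW andbT; apply: contraTneq lVW => ->.
  by rewrite subrr -leNgt divr_ge0 ?ler0n // ltW.
apply: contrapT => none.
have out n : (V < n <= W)%N -> a n < 2^-1 \/ 3 / 2 < a n.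
  move=> hn; case: (ltP (a n) 2^-1) => h1; first by left.
  case: (ltP (3 / 2) (a n)) => h2; first by right.
  by case: none; exists n; rewrite // h1 h2.
have step n : (V < n)%N -> (n < W)%N -> `|a n.+1 - a n| <= 4^-1.
  move=> Vn nW; apply: gap_density_near; last exact: leq_trans Ws.
    by rewrite (leq_ltn_trans _ Vn) //=.
  by rewrite -addn1 leq_add2l divn_gt0 // (leq_trans qV) // ltnW.
have V0W : (0 < V <= W)%N by rewrite V0.
have := gap_density_sum V0W WN; have := @sum_inv_range R V W V0W.
set l := ln W%:R - _ in lVW *; set H := \sum_(_ <= _ < _) _; set S := \sum_(_ <= _ < _) _.
(* [267 = 2 * 132 + 3]; the case of a density above [3 / 2] is the one that uses the full length. *)
have d3 : 3 <= 3 / delta by rewrite ler_pdivlMr //; have := delta_le1; lra.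
have {}lVW : 2 * (132 / delta) + 3 < l.
  have dE : 267 / delta = 2 * (132 / delta) + 3 / delta by ring.
  by move: lVW; rewrite dE; apply: le_lt_trans; rewrite lerD2l.
rewrite !ler_norml; set w := 132 / delta in lVW * => /andP[H1 H2] /andP[S1 S2].
have [b|b] := out V.+1 (introT andP (conj (ltnSn V) V1W)).
  have all n : (V < n <= W)%N -> a n < 2^-1.
    elim: n => // n IH; rewrite ltnS leq_eqVlt => /andP[/orP[/eqP <- //|Vn] nW].
    have := step n Vn nW; have [//|] := out n.+1 (introT andP (conj (leqW Vn) nW)).
    have := IH (introT andP (conj Vn (ltnW nW))); rewrite ler_norml => ? ? /andP[? ?]; lra.
  have : S <= 2^-1 * H.
    rewrite /S /H mulr_sumr big_nat [X in _ <= X]big_nat; apply: ler_sum => n hn.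
    by rewrite ler_wpM2r ?invr_ge0 // ltW // all.
  have w0 : 0 <= w by rewrite divr_ge0 ?ler0n // ltW.
  lra.
have all n : (V < n <= W)%N -> 3 / 2 < a n.
  elim: n => // n IH; rewrite ltnS leq_eqVlt => /andP[/orP[/eqP <- //|Vn] nW].
  have := step n Vn nW; have [|//] := out n.+1 (introT andP (conj (leqW Vn) nW)).
  have := IH (introT andP (conj Vn (ltnW nW))); rewrite ler_norml => ? ? /andP[? ?]; lra.
have : 3 / 2 * H <= S.
  rewrite /S /H mulr_sumr big_nat [X in _ <= X]big_nat; apply: ler_sum => n hn.
  by rewrite ler_wpM2r ?invr_ge0 // ltW // all.
lra.
Qed.

(** By [gap_density_near] both weights are at least [1 / 4] on the whole interval, whose mass comes
    from [sum_vonMangoldt2]. The bound [286 = 2 * 143] on [ln v / q] keeps the error below half of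
    the main term. *)
Lemma gap_window_mass v : 2^-1 <= a v <= 3 / 2 -> (2 * q <= v)%N ->
  (v + v %/ q <= N %/ s)%N -> 286 * q%:R <= ln (v%:R : R) ->
  ln v%:R / (16 * q%:R) <= \sum_(v.+1 <= k < (v + v %/ q).+1) gap_term t k.
Proof.
move=> /andP[av1 av2] qv v's lv; have q0 := window_q_gt0.
have v0 : (0 < v)%N by rewrite (leq_trans _ qv) // muln_gt0.
set v' := (v + v %/ q)%N in v's *.
have vv' : (v <= v')%N by exact: leq_addr.
have v'N : (v' <= N)%N by apply: leq_trans v's (leq_div _ _).
have v'2 : (v' <= 2 * v)%N by rewrite mul2n -addnn leq_add2l leq_div.
have v'0 := leq_trans v0 vv'.
have qp : (0 : R) < q%:R by rewrite ltr0n.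
have vp : (0 : R) < v%:R by rewrite ltr0n.
have v'p : (0 : R) < v'%:R by rewrite ltr0n.
apply: (@le_trans _ _ (4^-1 / v'%:R * \sum_(v.+1 <= k < v'.+1) vonMangoldt2 R k)); last first.
  rewrite mulr_sumr big_nat [X in _ <= X]big_nat; apply: ler_sum => k /andP[vk kv'].
  have k0 : (0 < k)%N by exact: leq_ltn_trans vk.
  have kN : (k <= N)%N by apply: leq_trans v'N.
  apply: (@le_trans _ _ (4^-1 * vonMangoldt2 R k / k%:R)).
    rewrite mulrAC ler_wpM2l //.
      by rewrite mulr_ge0 ?invr_ge0 ?vonMangoldt2_ge0.
    by rewrite lef_pV2 ?posrE ?ltr0n // ler_nat.
  have near : `|a k - a v| <= 4^-1.
    apply: gap_density_near; rewrite ?v0 ?(ltnW vk) //; exact: leq_trans v's.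
  move: near; rewrite ler_norml => /andP[n1 n2].
  apply: gap_term_ge => //; first by rewrite k0 kN.
    by apply/andP; split; lra.
  by have := gap_slack_ge0 t k; lra.
have /andP[A1 A2] := @sum_vonMangoldt2 R v v0; have /andP[] := @sum_vonMangoldt2 R v' v'0.
rewrite (big_cat_nat _ (n := v.+1)) //=; move: A1 A2.
set A := \sum_(_ <= _ < _) _; set B := \sum_(_ <= _ < _) _ => A1 A2 B1 B2.
have lvv : ln (v%:R : R) <= ln v'%:R by exact: ler_ln_nat.
have v'2r : (v'%:R : R) <= 2 * v%:R by rewrite -natrM ler_nat.
have grow : v%:R <= 2 * (q%:R * (v'%:R - v%:R)) :> R.
  rewrite /v' natrD [v%:R + _]addrC addrK -!natrM ler_nat.
  have z0 : (0 < v %/ q)%N by rewrite divn_gt0 // (leq_trans _ qv) // leq_pmull.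
  apply: leq_trans (ltnW (ltn_ceil v q0)) _.
  by rewrite mulSn mul2n -addnn mulnC leq_add2r leq_pmulr.
have l0 : 0 <= ln (v%:R : R) by exact: ln_nat_ge0.
rewrite ler_pdivrMr ?mulr_gt0 //.
have -> : 4^-1 / v'%:R * B * (16 * q%:R) = 4 * (q%:R * B) / v'%:R.
  by field; rewrite lt0r_neq0.
rewrite ler_pdivlMr //.
have B3 : 2 * (v'%:R - v%:R) * ln v%:R - 143 * v%:R <= B.
  have : v'%:R * ln v%:R <= v'%:R * ln (v'%:R : R) by rewrite ler_wpM2l.
  lra.
have B4 : q%:R * (2 * (v'%:R - v%:R) * ln v%:R - 143 * v%:R) <= q%:R * B by rewrite ler_pM2l.
have g2 : v%:R * ln (v%:R : R) <= 2 * (q%:R * (v'%:R - v%:R)) * ln v%:R by rewrite ler_wpM2r.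
have g3 : 286 * q%:R * v%:R <= ln (v%:R : R) * v%:R by rewrite ler_wpM2r.
have g4 : ln (v%:R : R) * v'%:R <= ln v%:R * (2 * v%:R) by rewrite ler_wpM2l.
exact: window_mass_arith g2 B4 g3 g4.
Qed.

(** A balanced [v] is found in [(V, B * V]], and its interval ends by [2 * v <= 2 * B * V]; hence
    the ratio [2 * B], which keeps the intervals of successive windows disjoint. *)
Lemma gap_windows_mass B J i : (0 < B)%N -> 267 / delta < ln (B%:R : R) ->
  (2 * q <= (2 * B) ^ J)%N -> 286 * q%:R <= ln (((2 * B) ^ J)%:R : R) ->
  ((2 * B) ^ (J + i) <= N %/ s)%N ->
  i%:R * (ln ((2 * B) ^ J)%:R / (16 * q%:R)) <=
    \sum_(((2 * B) ^ J).+1 <= k < ((2 * B) ^ (J + i)).+1) gap_term t k.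
Proof.
move=> B0 lB qJ lJ; have q0 := window_q_gt0.
have B20 : (0 < 2 * B)%N by rewrite muln_gt0.
elim: i => [|i IH] iN; first by rewrite mul0r addn0 big_geq.
have iiN : ((2 * B) ^ (J + i) <= N %/ s)%N.
  by apply: leq_trans iN; rewrite leq_pexp2l // leq_add2l.
set V := ((2 * B) ^ (J + i))%N.
have V0 : (0 < V)%N by rewrite expn_gt0 B20.
have JV : ((2 * B) ^ J <= V)%N by rewrite leq_pexp2l // leq_addr.
have VS : ((2 * B) ^ (J + i.+1) = 2 * (B * V))%N by rewrite addnS expnS mulnA.
have BVs : (B * V <= N %/ s)%N by apply: leq_trans iN; rewrite VS leq_pmull.
have := @gap_balanced_exists V (B * V)%N.
rewrite leq_pmull // andbT (leq_trans _ JV); last by apply: leq_trans qJ; rewrite leq_pmull.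
rewrite natrM lnM ?posrE ?ltr0n // addrK => /(_ isT BVs lB) [v /andP[Vv vB] av].
have v2 : (v + v %/ q <= 2 * (B * V))%N.
  by apply: (@leq_trans (2 * v)); [rewrite mul2n -addnn leq_add2l leq_div | rewrite leq_mul2l vB].
have := gap_window_mass av.
rewrite (leq_trans qJ (leq_trans JV (ltnW Vv))) (leq_trans v2) -?VS // => /(_ isT isT).
have lv : ln (((2 * B) ^ J)%:R : R) <= ln v%:R by apply: ler_ln_nat; rewrite (leq_trans JV) // ltnW.
move=> /(_ (le_trans lJ lv)) mass.
rewrite (big_cat_nat _ (n := V.+1)) //=; last by rewrite ltnS VS mulnA leq_pmull ?muln_gt0.
rewrite -natr1 mulrDl mul1r lerD ?IH //.
apply: (@le_trans _ _ (ln v%:R / (16 * q%:R))).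
  by rewrite ler_wpM2r // invr_ge0 mulr_ge0.
apply: le_trans mass _.
rewrite [X in _ <= X](big_cat_nat _ (n := v.+1)) //=; last 2 first.
- by rewrite ltnS ltnW.
- by rewrite ltnS VS (leq_trans vB) // leq_pmull.
rewrite [X in _ <= _ + X](big_cat_nat _ (n := (v + v %/ q).+1)) //=; last 2 first.
- by rewrite ltnS leq_addr.
- by rewrite ltnS VS.
have term0 m n : (n <= N)%N -> 0 <= \sum_(m.+1 <= k < n.+1) gap_term t k.
  move=> nN; rewrite big_nat; apply: sumr_ge0 => k /andP[mk kn].
  by apply: gap_term_ge0; rewrite // (leq_ltn_trans _ mk) //= (leq_trans _ nN).
have wN : ((2 * B) ^ (J + i.+1) <= N)%N by apply: leq_trans iN (leq_div _ _).
rewrite addrCA lerDl addr_ge0 //; last exact: term0.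
by apply: term0; apply: leq_trans wN; rewrite VS (leq_trans vB) // leq_pmull.
Qed.

Lemma gap_form_ge B J : (0 < B)%N -> 267 / delta < ln (B%:R : R) ->
  (2 * q <= (2 * B) ^ J)%N -> 286 * q%:R <= ln (((2 * B) ^ J)%:R : R) ->
  ((2 * B) ^ (J + J) <= N %/ s)%N ->
  J%:R * (ln ((2 * B) ^ J)%:R / (16 * q%:R)) <= gap_form (fun k => 2 - a k + gap_slack t k).
Proof.
move=> B0 lB qJ lJ JN; apply: le_trans (gap_windows_mass B0 lB qJ lJ JN) _.
have wN : ((2 * B) ^ (J + J) <= N)%N by apply: leq_trans JN (leq_div _ _).
have JJ : ((2 * B) ^ J <= (2 * B) ^ (J + J))%N by rewrite leq_pexp2l ?muln_gt0 // leq_addr.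
have term0 m n : (n <= N)%N -> 0 <= \sum_(m.+1 <= k < n.+1) gap_term t k.
  move=> nN; rewrite big_nat; apply: sumr_ge0 => k /andP[mk kn].
  by apply: gap_term_ge0; rewrite // (leq_ltn_trans _ mk) //= (leq_trans _ nN).
have -> : gap_form (fun k => 2 - a k + gap_slack t k) = \sum_(1 <= k < N.+1) gap_term t k by [].
rewrite [X in _ <= X](big_cat_nat _ (n := ((2 * B) ^ J).+1)) //=; last by rewrite ltnS (leq_trans JJ).
rewrite [X in _ <= _ + X](big_cat_nat _ (n := ((2 * B) ^ (J + J)).+1)) //=.
by rewrite addrCA lerDl addr_ge0 ?term0 // (leq_trans JJ).
Qed.

End Windows.
End PrimeGap.

(** * Prime powers in short intervals *)

Section PrimePowers.
Variable R : realType.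

Lemma ln_unbounded (x : R) : exists2 n, (0 < n)%N & forall m, (n <= m)%N -> x < ln m%:R.
Proof.
exists (Num.bound (expR x)).+1 => // m nm.
have e0 := expR_gt0 x; have h := archi_boundP (ltW e0).
have mp : (0 : R) < m%:R by rewrite ltr0n (leq_trans _ nm).
rewrite -[x]expRK ltr_ln ?posrE //; apply: lt_le_trans h _.
by rewrite ler_nat ltnW.
Qed.

Lemma quadratic_le (k c e l : R) : 0 < k -> 0 <= c -> 1 <= l ->
  k * l ^+ 2 <= c + e * l -> l <= (c + e) / k.
Proof.
move=> k0 c0 l1 h; rewrite ler_pdivlMr //.
have l0 : 0 < l by lra.
rewrite -(ler_pM2l l0) (_ : l * (l * k) = k * l ^+ 2); last by ring.
by apply: le_trans h _; rewrite mulrDr; apply: lerD; [rewrite ler_peMl | rewrite mulrC].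
Qed.

(** For a gap, the windows force [gap_form] with slack above [2 * kap * (ln N)^2], while
    [gap_form_slack_le] allows only [kap * (ln N)^2 + O(ln N)]. *)
Lemma chebyshev_psi_gap (delta : R) : 0 < delta <= 1 ->
  exists N0, forall N M, (N0 <= N)%N -> (1 + delta) * N%:R <= M%:R -> (M <= 2 * N)%N ->
  chebyshev_psi R M != chebyshev_psi R N.
Proof.
move=> /andP[d0 d1].
pose c1 := 200 / delta; have c10 : 0 < c1 by rewrite divr_gt0 ?ltr0n.
pose q := (Num.bound c1).+1.
have qr : c1 <= q%:R.
  by apply: le_trans (ltW (archi_boundP (ltW c10))) _; rewrite ler_nat.
have qp : (0 : R) < q%:R by rewrite ltr0n.
have [s s0 /(_ s (leqnn _)) /ltW sr] := ln_unbounded (2720 / delta).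
have [B B0 /(_ B (leqnn _)) Br] := ln_unbounded (267 / delta).
set b := (2 * B)%N; have b1 : (1 < b)%N by rewrite /b; case: B B0 {Br} @b => // n _; rewrite mulnS.
pose l2 := ln (b%:R : R); have l20 : 0 < l2 by rewrite ln_gt0 // ltr1n.
(* [288 = 16 * 18]: with [ln N <= 3 * J * l2], the mass [J^2 * l2 / (16 * q)] of the windows is at
   least [2 * kap * (ln N)^2]. *)
pose kap := (288 * q%:R * l2)^-1.
have kap0 : 0 < kap by rewrite invr_gt0 !mulr_gt0 ?ltr0n.
have [t t0 /(_ _ (leqnn _)) tr] := ln_unbounded (c1 / kap).
have lt0 : 0 < ln (t%:R : R) by apply: lt_trans tr; rewrite divr_gt0.
have t1 : (1 < t)%N.
  by rewrite ltnNge; apply/negP => tt; move: lt0; rewrite ltNge ln_le0 // lern1.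
have tk : c1 / ln t%:R <= kap by rewrite ler_pdivrMr // -ler_pdivrMl // mulrC ltW.
pose D := 20 / delta * (ln t%:R + 12).
(* The three entries make [b ^ J] exceed [2 * q], make its logarithm large for [gap_window_mass],
   and absorb [s] and the rounding of [J] into [ln N <= 3 * J * l2]. *)
pose J0 := maxn (2 * q) (maxn (Num.bound (286 * q%:R / l2 : R)) (Num.bound (2 + ln s%:R / l2))).
have [N1 N10 N1r] := ln_unbounded (Num.max 1 ((20 * c1 + (20 * c1 + 10 * kap + D)) / kap)).
exists (maxn (s * b ^ (J0 + J0).+2) (maxn N1 t)) => N M.
rewrite !geq_max => /andP[sN /andP[N1N tN]] MN M2; apply/negP => /eqP psiE.
have N0 : (0 < N)%N by exact: leq_trans N1N.
have := N1r N N1N; rewrite gt_max => /andP[l1 lbig].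
(* Thus [N %/ s] lies between [b ^ (2 * J)] and [b ^ (2 * J + 2)]. *)
set J := (trunc_log b (N %/ s))./2.
have Ns0 : (b ^ (J0 + J0).+2 <= N %/ s)%N by rewrite leq_divRL // mulnC.
have Nsp : (0 < N %/ s)%N by apply: leq_trans Ns0; rewrite expn_gt0 ltnW.
have [tl1 tl2] := andP (trunc_log_bounds b1 Nsp).
have J0J : (J0 <= J)%N.
  have : ((J0 + J0).+2 <= trunc_log b (N %/ s))%N by apply: trunc_log_max.
  by rewrite /J addnn geq_half_double => h; do 2! apply: ltnW.
have JJN : (b ^ (J + J) <= N %/ s)%N.
  by apply: leq_trans tl1; rewrite leq_pexp2l ?(ltnW b1) // /J addnn -geq_half_double.
have JN : (N < s * b ^ (J + J).+2)%N.
  rewrite mulnC -ltn_divLR //; apply: leq_trans tl2 _.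
  rewrite leq_pexp2l ?(ltnW b1) // /J addnn ltnS -[X in (X <= _)%N]odd_double_half.
  by case: (odd _); rewrite ?add1n ?add0n.
have J1 : (2 * q <= J)%N by apply: leq_trans J0J; rewrite leq_maxl.
have lbJ : ln ((b ^ J)%:R : R) = J%:R * l2 by rewrite natrX lnXn ?ltr0n ?(ltnW b1) // mulr_natl.
have J2 : 286 * q%:R <= ln ((b ^ J)%:R : R).
  rewrite lbJ -ler_pdivrMr //.
  apply: (@le_trans _ _ (Num.bound (286 * q%:R / l2 : R))%:R).
    by apply: ltW; apply: archi_boundP; rewrite divr_ge0 ?mulr_ge0 ?ler0n // ltW.
  by rewrite ler_nat (leq_trans _ J0J) // /J0 leq_max leq_maxl orbT.
have qJ : (2 * q <= b ^ J)%N by apply: leq_trans J1 _; apply: ltnW; apply: ltn_expl.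
have J3 : 2 + ln s%:R / l2 <= J%:R.
  apply: (@le_trans _ _ (Num.bound (2 + ln s%:R / l2 : R))%:R).
    by apply: ltW; apply: archi_boundP; rewrite addr_ge0 ?divr_ge0 ?ln_nat_ge0 // ltW.
  by rewrite ler_nat (leq_trans _ J0J) // /J0 !leq_max leqnn !orbT.
have lNJ : ln (N%:R : R) <= 3 * (J%:R * l2).
  apply: (@le_trans _ _ (ln (s * b ^ (J + J).+2)%:R)); first by rewrite ler_ln_nat // ltnW.
  have bp : (0 < b)%N by rewrite ltnW.
  rewrite natrM lnM ?posrE ?ltr0n ?expn_gt0 ?bp // natrX lnXn ?ltr0n // -/l2 -[l2 *+ _]mulr_natl.
  have : (2 + ln s%:R / l2) * l2 <= J%:R * l2 by rewrite ler_wpM2r // ltW.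
  rewrite mulrDl divfK ?lt0r_neq0 // (_ : (J + J).+2%:R = J%:R + J%:R + 2 :> R); last by rewrite -addn2 !natrD.
  move: (ln s%:R) => y; lra.
have h1 := @gap_form_ge R N M delta d0 d1 N0 MN M2 q s t qr sr t1 B J B0 Br qJ J2 JJN.
have tN' : (1 < t <= N)%N by rewrite t1 tN.
have h2 := @gap_form_slack_le R N M delta d0 d1 N0 MN M2 psiE t tN'.
have {h1 h2} h := le_trans h1 h2.
move: h; rewrite lbJ -/l2 /gap_error -/c1; set l := ln N%:R in l1 lbig lNJ *.
set x := J%:R * l2 in lNJ *.
have -> : J%:R * (x / (16 * q%:R)) = 18 * kap * x ^+ 2.
  by rewrite /x /kap; field; rewrite !lt0r_neq0.
have lx : l ^+ 2 <= (3 * x) ^+ 2 by rewrite ler_sqr ?nnegrE //; lra.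
have lx2 : 2 * kap * l ^+ 2 <= 18 * kap * x ^+ 2.
  have -> : 18 * kap * x ^+ 2 = 2 * kap * (3 * x) ^+ 2 by ring.
  by rewrite ler_wpM2l // mulr_ge0 // ltW.
have tk2 : c1 / ln t%:R * (l + 10) <= kap * (l + 10) by rewrite ler_wpM2r //; lra.
have tk3 : l * (c1 / ln t%:R * (l + 10) + D) <= l * (kap * (l + 10) + D).
  by rewrite ler_wpM2l ?lerD2r //; lra.
move=> h; have {}h := le_trans lx2 (le_trans h (_ : _ <= 20 * c1 * (1 + l) + l * (kap * (l + 10) + D))).
have : kap * l ^+ 2 <= 20 * c1 + (20 * c1 + 10 * kap + D) * l.
  have := h; rewrite lerD2l => /(_ tk3) {}h.
  have E : 20 * c1 * (1 + l) + l * (kap * (l + 10) + D) =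
     kap * l ^+ 2 + (20 * c1 + (20 * c1 + 10 * kap + D) * l) by ring.
  by move: h; rewrite E -lerBlDl; apply: le_trans; rewrite le_eqVlt; apply/orP; left; apply/eqP; ring.
move/quadratic_le => /(_ kap0); rewrite mulr_ge0 ?(ltW c10) // => /(_ isT (ltW l1)).
by rewrite leNgt lbig.
Qed.

Lemma prime_power_between (delta : R) : 0 < delta -> exists N0, forall N, (N0 <= N)%N ->
  exists p i, [/\ prime p, (0 < i)%N, (N < p ^ i)%N & (p ^ i)%:R <= (1 + delta) * N%:R].
Proof.
move=> d0; pose d := Num.min delta 1.
have dp : 0 < d by rewrite lt_min d0 ltr01.
have dd : d <= delta by rewrite ge_min lexx.
have d1 : d <= 1 by rewrite ge_min lexx orbT.
(* Only half of [d] is used: the other half pays for truncating [(1 + d) * N] to the integer [M]. *)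
have [|N0 hN] := @chebyshev_psi_gap (d / 2); first by apply/andP; split; lra.
exists (maxn N0 (Num.bound (2 / d))) => N; rewrite geq_max => /andP[NN0 Nd].
have Ndr : 2 / d <= N%:R.
  apply: le_trans (ltW (archi_boundP _)) _; first by rewrite divr_ge0 // ltW.
  by rewrite ler_nat.
have dN : 2 <= d * N%:R by move: Ndr; rewrite ler_pdivrMr // mulrC.
have x0 : 0 <= (1 + d) * N%:R by rewrite mulr_ge0 // addr_ge0 // ltW.
set M := Num.truncn ((1 + d) * N%:R).
have /andP[M1 M2] := truncn_itv x0; rewrite -/M -natr1 in M1 M2.
have M3 : (1 + d / 2) * N%:R <= M%:R by move: dN M2; lra.
have M4 : (M <= 2 * N)%N.
  rewrite -(ler_nat R) natrM; apply: le_trans M1 _.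
  by rewrite ler_wpM2r //; lra.
have NM : (N <= M)%N.
  rewrite -(ler_nat R); apply: le_trans M3; rewrite ler_peMl // lerDl; lra.
have := hN N M NN0 M3 M4; rewrite (psi_cat R NM) => ne.
have [k /andP[Nk kM] nz] : exists2 k, (N < k <= M)%N & vonMangoldt R k != 0.
  apply: contrapT => none; move: ne; rewrite big_nat big1 ?addr0 ?eqxx // => k kr.
  by apply/eqP; apply: contrapT => /negP nz; apply: none; exists k.
have [p [i [pp i0 kE]]] := vonMangoldt_neq0 nz.
exists p, i; split=> //; rewrite -kE //.
apply: (@le_trans _ _ M%:R); first by rewrite ler_nat.
by apply: le_trans M1 _; rewrite ler_wpM2r // lerD2l.
Qed.

End PrimePowers.

(** * Colouring by polynomial coefficients *)

Section PolynomialColoring.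
Variables (n k r : nat) (F : finFieldType).
Hypotheses (n_def : n = (2 * k + r)%N) (n_le : (n <= #|F|)%N).
Implicit Types A B : {set 'I_n}.

Definition field_point (i : 'I_n) : F := enum_val (widen_ord n_le i).

Lemma field_point_inj : injective field_point.
Proof. by move=> i j /enum_val_inj /(congr1 (@nat_of_ord _)) /= /ord_inj. Qed.

Definition root_poly A : {poly F} := \prod_(i in A) ('X - (field_point i)%:P).

Lemma size_root_poly A : size (root_poly A) = #|A|.+1.
Proof. by rewrite /root_poly -big_enum size_prod_XsubC cardE. Qed.

Lemma monic_root_poly A : root_poly A \is monic.
Proof. exact: monic_prod_XsubC. Qed.

Lemma root_root_poly A i : root (root_poly A) (field_point i) = (i \in A).
Proof.
rewrite rootE horner_prod prodf_seq_eq0; apply/hasP/idP => [[j _]|iA].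
  by rewrite hornerXsubC subr_eq0 => /andP[jA /eqP /field_point_inj ->].
by exists i; rewrite ?mem_index_enum // iA hornerXsubC subrr /=.
Qed.

Lemma root_poly_inj : injective root_poly.
Proof. by move=> A B AB; apply/setP => i; rewrite -!root_root_poly AB. Qed.

Lemma dvdp_root_poly A B : A \subset B -> root_poly A %| root_poly B.
Proof.
move=> /finset.setIidPr AB; rewrite /root_poly [X in _ %| X](big_setID A) /= AB.
by rewrite dvdp_mulr.
Qed.

(** For [j >= k] the truncated index repeats the constant coefficient. *)
Definition coefficient_color A : {ffun 'I_r -> F} := [ffun j : 'I_r => (root_poly A)`_(k - j.+1)].

(* The difference of the two polynomials has size at most k - r and is divisible by the
   polynomial of A :&: B, of size at least k - r + 1. *)
Lemma coefficient_color_inj A B : #|A| = k -> #|B| = k -> (#|A :|: B| <= k + r)%N ->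
  coefficient_color A = coefficient_color B -> A = B.
Proof.
move=> cA cB cAB /ffunP col; apply: root_poly_inj; apply/eqP; rewrite -subr_eq0.
have top (C : {set _}) i : #|C| = k -> (k <= i)%N -> (root_poly C)`_i = (i == k)%:R.
  move=> cC; rewrite leq_eqVlt => /orP[/eqP <-|ki].
    by have := monicP (monic_root_poly C); rewrite lead_coefE size_root_poly cC eqxx.
  by rewrite nth_default ?gtn_eqF // size_root_poly cC.
apply: contraT => nz.
have dv : root_poly (A :&: B) %| root_poly A - root_poly B.
  by rewrite dvdp_sub // dvdp_root_poly ?subsetIl ?subsetIr.
have := dvdp_leq nz dv; rewrite size_root_poly.
have : (size (root_poly A - root_poly B)%R <= k - r)%N.
  apply/leq_sizeP => i; rewrite leq_subLR addnC => ri; rewrite coefB.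
  have [ki|ik] := leqP k i; first by rewrite !top // subrr.
  have jr : (k - i.+1 < r)%N by lia.
  have := col (Ordinal jr); rewrite !ffunE /= (_ : k - (k - i.+1).+1 = i)%N; last by lia.
  by move=> ->; rewrite subrr.
have := cardsUI A B; rewrite cA cB => e h1 h2.
have := leq_trans h2 h1; lia.
Qed.

(** A common neighbour is a [k]-set disjoint from the union of both vertices, which therefore has at
    most [n - k = k + r] elements. *)
Lemma coefficient_coloring : injective_colorable (@kneser_adj n k) (#|F| ^ r).
Proof.
have card_eq : #|{ffun 'I_r -> F}| = (#|F| ^ r)%N by rewrite card_ffun card_ord.
apply/existsP; exists [ffun x : kneser_vertex n k =>
  cast_ord card_eq (enum_rank (coefficient_color (val x)))].
apply/forallP => x; apply/forallP => y; apply/implyP => /andP[xy /existsP[z /andP[xz yz]]].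
apply: contra xy; rewrite !ffunE => /eqP /cast_ord_inj /enum_rank_inj col.
have cv (w : kneser_vertex n k) : #|val w| = k by exact/eqP/(valP w).
have dz : [disjoint val x :|: val y & val z].
  move: xz yz; rewrite /kneser_adj => xz yz.
  by rewrite -finset.setI_eq0 finset.setIUl finset.setU_eq0 !finset.setI_eq0 xz yz.
have cU : (#|val x :|: val y| <= k + r)%N.
  have := max_card (mem (val x :|: val y :|: val z)); rewrite card_ord.
  have := cardsUI (val x :|: val y) (val z); move: dz; rewrite -finset.setI_eq0 => /eqP ->.
  by rewrite cards0 addn0 => ->; rewrite cv => h; lia.
by apply/eqP; apply: val_inj; exact: coefficient_color_inj (cv x) (cv y) cU col.
Qed.

Lemma injective_chromatic_number_le : (injective_chromatic_number (@kneser_adj n k) <= #|F| ^ r)%N.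
Proof.
rewrite /injective_chromatic_number; case: ex_minnP => m _; apply; exact: coefficient_coloring.
Qed.

End PolynomialColoring.

(** * Passage to the limit superior *)

Lemma add_expr_le (R : realFieldType) (e : R) r : 0 <= e <= 1 ->
  (2 + e) ^+ r <= 2 ^+ r + e * 4 ^+ r.
Proof.
move=> /andP[e0 e1]; elim: r => [|r IH]; first by rewrite !expr0 mulr1; lra.
rewrite !exprS; apply: (@le_trans _ _ ((2 + e) * (2 ^+ r + e * 4 ^+ r))).
  by rewrite ler_wpM2l //; lra.
have p2 : 2 ^+ r <= 4 ^+ r :> R by apply: lerXn2r; rewrite ?nnegrE //; lra.
have p0 : 0 <= 2 ^+ r :> R by rewrite exprn_ge0.
move: (2 ^+ r) (4 ^+ r) p0 p2 => x y x0 xy.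
have : e * x <= e * y by rewrite ler_wpM2l.
have : e * (e * y) <= 1 * (e * y) by rewrite ler_wpM2r // mulr_ge0 //; lra.
lra.
Qed.

Lemma limn_esup_le (R : realType) (u : nat -> \bar R) (c : \bar R) N :
  (forall k, (N <= k)%N -> (u k <= c)%E) -> (limn_esup u <= c)%E.
Proof.
move=> uc; rewrite limn_esup_lim; apply: lime_le; first exact: is_cvg_esups.
exists N => // m /= Nm; apply: ge_ereal_sup => _ [i /= mi <-].
by apply: uc; exact: leq_trans mi.
Qed.

Theorem theorem4p4 (R : realType) (r : nat) (hr : (2 <= r)%N)
    (eps : R) (heps : (0 < eps)%R) :
  (limn_esup (fun k : nat =>
     ((injective_chromatic_number (@kneser_adj (2 * k + r) k))%:R / k%:R ^+ r : R)%:E)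
   <= (2 ^+ r + eps)%:E)%E.
Proof.
have p4 : 0 < 4 ^+ r :> R by rewrite exprn_gt0.
(* By [add_expr_le], this [e] gives [(2 + e)^r <= 2^r + eps]. *)
pose e : R := Num.min 1 (eps / 4 ^+ r).
have e0 : 0 < e by rewrite lt_min ltr01 divr_gt0.
have e1 : e <= 1 by rewrite ge_min lexx.
have e4 : e * 4 ^+ r <= eps by rewrite -ler_pdivlMr // ge_min lexx orbT.
(* Chosen so that [(1 + d) * (2 + d) <= 2 + 4 * d = 2 + e]. *)
pose d := e / 4; have d0 : 0 < d by rewrite divr_gt0.
have d1 : d <= 1 by rewrite /d; lra.
have [N0 hN] := @prime_power_between R d d0.
(* The second threshold gives [k > 0] and [r <= d * k], hence [2 * k + r <= (2 + d) * k]. *)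
apply: (@limn_esup_le _ _ _ (maxn N0 (Num.bound (r%:R / d : R)).+1)) => k.
rewrite geq_max => /andP[Nk bk].
have kp : (0 : R) < k%:R by rewrite ltr0n (leq_ltn_trans _ bk).
have rk : r%:R <= d * k%:R.
  rewrite mulrC -ler_pdivrMr //; apply: le_trans (ltW (archi_boundP _)) _.
    by rewrite divr_ge0 // ltW.
  by rewrite ler_nat ltnW.
have Nn : (N0 <= 2 * k + r)%N by rewrite (leq_trans Nk) // mul2n -addnn -addnA leq_addr.
have [p [i [pp i0 np pn]]] := hN _ Nn.
have [F _ cF] := pPrimePowerField pp i0.
have nF : (2 * k + r <= #|F|)%N by rewrite cF ltnW.
have chi := injective_chromatic_number_le (erefl (2 * k + r)%N) nF.
rewrite lee_fin ler_pdivrMr ?exprn_gt0 //.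
apply: (@le_trans _ _ ((2 + e) ^+ r * k%:R ^+ r)); last first.
  rewrite ler_pM2r ?exprn_gt0 // (le_trans (add_expr_le r _)) ?lerD2l //.
  by rewrite (ltW e0) e1.
rewrite -exprMn; apply: (@le_trans _ _ (#|F|%:R ^+ r)); first by rewrite -natrX ler_nat.
apply: lerXn2r; rewrite ?nnegrE ?mulr_ge0 ?addr_ge0 ?(ltW e0) //.
rewrite cF; apply: le_trans pn _; rewrite natrD natrM.
apply: (@le_trans _ _ ((1 + d) * (2 * k%:R + d * k%:R))).
  by rewrite ler_wpM2l ?lerD2l // addr_ge0 // ltW.
rewrite -mulrDl mulrA ler_wpM2r //.
have : d * d <= d * 1 by rewrite ler_wpM2l // ltW.
have : e = 4 * d by rewrite /d mulrC divfK.
by move=> ->; lra.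
Qed.
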